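(* Let $A$ be a Hopf algebra with bijective antipode, $\Lambda^1$ a right $A$-crossed module and $\theta\in\Lambda^1$ with $\Delta_R\theta=\theta\otimes1$, defining an inner generalised first order bicovariant differential calculus, and let $\Omega_\theta(A)=A\#\Lambda_\theta(\Lambda^1)$ be the associated inner strongly bicovariant differential exterior algebra with $\mathrm{d}=[\theta,\ \}$. Suppose $i:\Lambda^1\to A^+$ is a right $A$-crossed module map, where $A^+$ has the crossed module structure $a\triangleleft b=(Sb_{(1)})ab_{(2)}$, $\Delta_Ra=\Delta a-1\otimes a$. Then $\Omega_\theta(A)$ is augmented by $i$ if and only if $\theta\triangleleft i(\theta)$ is graded central in $\Omega_\theta(A)$.
   Context: We work over a field $k$ of characteristic not $2$. $A^+=\ker\epsilon$. A right $A$-crossed module is a vector space $V$ with right action $\triangleleft$ and right coaction $\Delta_Rv=v_0\otimes v_1$ of $A$ such that $\Delta_R(v\triangleleft a)=v_0\triangleleft a_{(2)}\otimes(Sa_{(1)})v_1a_{(3)}$; these form a braided category with $\Psi(v\otimes w)=w_0\otimes v\triangleleft w_1$. $T_-\Lambda^1$ is the tensor algebra with its braided-super Hopf algebra structure in which $\Lambda^1$ is odd and primitive ($\underline\Delta v=v\otimes1+1\otimes v$), and $\Lambda_\theta(\Lambda^1)=T_-\Lambda^1/\langle\theta^2\triangleleft a,\ [\theta^2,\eta]\mid a\in A^+,\eta\in\Lambda^1\rangle$, a braided-super Hopf algebra quotient. For a braided-super Hopf algebra $\Lambda$ in this category, $A\#\Lambda$ is the super-Hopf algebra $A\otimes\Lambda$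 with $(a\otimes\eta)(b\otimes\zeta)=ab_{(1)}\otimes(\eta\triangleleft b_{(2)})\zeta$ and $\Delta(a\otimes\eta)=a_{(1)}\otimes(\eta^1)_0\otimes a_{(2)}(\eta^1)_1\otimes\eta^2$. $[\theta,u\}=\theta u-(-1)^{|u|}u\theta$; an element $x$ of $\Omega_\theta(A)$ is graded central if $[x,\eta\}=0$ for all $\eta\in\Omega_\theta(A)$ (graded commutator). A strongly bicovariant differential exterior algebra $(\Omega,\mathrm{d})$ is augmented if equipped with a degree $-1$ map $i:\Omega\to\Omega$, $i^2=0$, that is a super-derivation and a super-coderivation ($\Delta i=(i\otimes\mathrm{id}+(-1)^{|\ |}\otimes i)\Delta$). ''Augmented by $i$'' means that the first order map $i:A\otimes\Lambda^1\to A$, $i(a\otimes v)=a\,i(v)$, extends (necessarily as a super-derivation, zero on $A$) to such a map on $\Omega_\theta(A)$. *)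

(* Defs.v *)
From HB Require Import structures.
From mathcomp Require Import all_boot all_order all_algebra sesquilinear.
From mathcomp Require Import boolp.

Set Implicit Arguments.
Unset Strict Implicit.
Unset Printing Implicit Defensive.

Import GRing.Theory.

Local Open Scope ring_scope.
Local Open Scope quotient_scope.

Reserved Notation "v \ox w" (at level 45, left associativity).
Reserved Notation "\sw_ ( x , y <- t ) e"
  (at level 41, e at level 41, x name, y name, t at level 60,
   format "\sw_ ( x ,  y  <-  t )  e").

(* Tensor products of (possibly infinite-dimensional) vector spaces: an element
   of [tens V W] is a finite family of pairs (v, w), read as the sum of the
   v \ox w; two families are identified when every bilinear map out of V x W
   takes the same total value on them. *)
Section Tensor.
Variables (k : fieldType) (V W : lmodType k).
Implicit Types (s t : seq (V * W)).

Definition tsum (U : lmodType k) (b : V -> W -> U) s : U :=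
  \sum_(p <- s) b p.1 p.2.

Definition tens_rel s t : bool :=
  `[< forall (U : lmodType k) (b : V -> W -> U),
        bilinear_for *:%R *:%R b -> tsum b s = tsum b t >].

Lemma tens_relP s t :
  reflect (forall (U : lmodType k) (b : V -> W -> U),
             bilinear_for *:%R *:%R b -> tsum b s = tsum b t) (tens_rel s t).
Proof. exact: asboolP. Qed.

Lemma tens_rel_refl : reflexive tens_rel.
Proof. by move=> s; apply/tens_relP. Qed.

Lemma tens_rel_sym : symmetric tens_rel.
Proof.
by move=> s t; apply/tens_relP/tens_relP => h U b bb; rewrite h.
Qed.

Lemma tens_rel_trans : transitive tens_rel.
Proof.
move=> s t u /tens_relP h1 /tens_relP h2; apply/tens_relP => U b bb.
by rewrite h1 // h2.
Qed.

Canonical tens_equiv := EquivRel tens_rel tens_rel_refl tens_rel_sym tens_rel_trans.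

Definition tens := {eq_quot tens_rel}.

HB.instance Definition _ : EqQuotient _ tens_rel tens := EqQuotient.on tens.
HB.instance Definition _ := Choice.on tens.

Definition tmul (v : V) (w : W) : tens := \pi_tens [:: (v, w)].

(* The linear map induced by b, computed on a chosen representative of x; it
   is meaningful when b is bilinear, see [tliftE]. *)
Definition tlift (U : lmodType k) (x : tens) (b : V -> W -> U) : U :=
  tsum b (repr x).

Lemma tlift_pi (U : lmodType k) (b : V -> W -> U) s :
  bilinear_for *:%R *:%R b -> tlift (\pi_tens s) b = tsum b s.
Proof.
move=> bb; rewrite /tlift; have /eqmodP/tens_relP : repr (\pi_tens s) = s %[mod tens].
  by rewrite reprK.
exact.
Qed.

Lemma tens_eqP (x y : tens) :
  (forall (U : lmodType k) (b : V -> W -> U),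
     bilinear_for *:%R *:%R b -> tlift x b = tlift y b) -> x = y.
Proof.
by move=> h; rewrite -[x]reprK -[y]reprK; apply/eqmodP/tens_relP.
Qed.

Definition tens_zero : tens := \pi_tens [::].
Definition tens_add (x y : tens) : tens := \pi_tens (repr x ++ repr y).
Definition tens_scale (a : k) (x : tens) : tens :=
  \pi_tens [seq (a *: p.1, p.2) | p <- repr x].
Definition tens_opp (x : tens) : tens := tens_scale (-1) x.

Section Lift.
Variables (U : lmodType k) (b : V -> W -> U).
Hypothesis bb : bilinear_for *:%R *:%R b.

Lemma tlift_zero : tlift tens_zero b = 0.
Proof. by rewrite tlift_pi // /tsum big_nil. Qed.

Lemma tlift_add x y : tlift (tens_add x y) b = tlift x b + tlift y b.
Proof. by rewrite tlift_pi // /tsum big_cat. Qed.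

Lemma tlift_scale a x : tlift (tens_scale a x) b = a *: tlift x b.
Proof.
rewrite tlift_pi // /tsum big_map scaler_sumr; apply: eq_bigr => p _ /=.
exact: (scalable_linear (bb.1 p.2)).
Qed.

Lemma tlift_opp x : tlift (tens_opp x) b = - tlift x b.
Proof. by rewrite tlift_scale scaleN1r. Qed.

End Lift.

Lemma tens_addA : associative tens_add.
Proof. by move=> x y z; apply: tens_eqP => U b bb; rewrite !tlift_add // addrA. Qed.
Lemma tens_addC : commutative tens_add.
Proof. by move=> x y; apply: tens_eqP => U b bb; rewrite !tlift_add // addrC. Qed.
Lemma tens_add0 : left_id tens_zero tens_add.
Proof. by move=> x; apply: tens_eqP => U b bb; rewrite tlift_add // tlift_zero // add0r. Qed.
Lemma tens_addN : left_inverse tens_zero tens_opp tens_add.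
Proof.
by move=> x; apply: tens_eqP => U b bb; rewrite tlift_add // tlift_opp // tlift_zero // addNr.
Qed.

HB.instance Definition _ :=
  GRing.isZmodule.Build tens tens_addA tens_addC tens_add0 tens_addN.

Lemma tens_scaleA a c x : tens_scale a (tens_scale c x) = tens_scale (a * c) x.
Proof. by apply: tens_eqP => U b bb; rewrite !tlift_scale // scalerA. Qed.
Lemma tens_scale1 : left_id 1 tens_scale.
Proof. by move=> x; apply: tens_eqP => U b bb; rewrite tlift_scale // scale1r. Qed.
Lemma tens_scaleDr : right_distributive tens_scale +%R.
Proof.
by move=> a x y; apply: tens_eqP => U b bb; rewrite !(tlift_scale, tlift_add) // scalerDr.
Qed.
Lemma tens_scaleDl x : {morph tens_scale^~ x : a c / a + c}.
Proof.
by move=> a c; apply: tens_eqP => U b bb; rewrite !(tlift_scale, tlift_add) // scalerDl.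
Qed.

HB.instance Definition _ :=
  GRing.Zmodule_isLmodule.Build k tens tens_scaleA tens_scale1 tens_scaleDr tens_scaleDl.

Lemma tliftE (U : lmodType k) (b : V -> W -> U) v w :
  bilinear_for *:%R *:%R b -> tlift (tmul v w) b = b v w.
Proof. by move=> bb; rewrite tlift_pi // /tsum big_seq1. Qed.

Lemma tlift_linear (U : lmodType k) (b : V -> W -> U) :
  bilinear_for *:%R *:%R b -> linear (fun x => tlift x b).
Proof. by move=> bb a x y; rewrite /= [LHS]tlift_add // tlift_scale. Qed.

Lemma tmul_bilinear : bilinear_for *:%R *:%R tmul.
Proof.
split=> [w a v v'|v a w w']; apply: tens_eqP => U b bb.
- by rewrite [RHS]tlift_add // tlift_scale // !tliftE // (bb.1 w).
- by rewrite [RHS]tlift_add // tlift_scale // !tliftE // (bb.2 v).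
Qed.

HB.instance Definition _ :=
  bilinear_isBilinear.Build k V W tens *:%R *:%R tmul tmul_bilinear.

Lemma tens_sum (x : tens) : x = \sum_(p <- repr x) tmul p.1 p.2.
Proof.
apply: tens_eqP => U b bb; rewrite {1}/tlift /tsum; move: (repr x) => s.
elim: s => [|p s IH]; first by rewrite !big_nil [RHS]tlift_zero.
by rewrite !big_cons [RHS]tlift_add // tliftE // IH.
Qed.

End Tensor.

Arguments tens {k} V W.
Arguments tmul {k V W} v w.
Arguments tlift {k V W U} x b.

Notation "v \ox w" := (tmul v w) : ring_scope.
(* Sweedler-style sums: t = x \ox y (summation understood). *)
Notation "\sw_ ( x , y <- t ) e" := (tlift t (fun x y => e)) : ring_scope.

Definition tmap (k : fieldType) (V V' W W' : lmodType k)
    (f : V -> V') (g : W -> W') (t : tens V W) : tens V' W' :=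
  \sw_(v, w <- t) (f v \ox g w).

Definition tensM (k : fieldType) (A B : algType k) (s t : tens A B) : tens A B :=
  \sw_(a, b <- s) \sw_(c, d <- t) ((a * c) \ox (b * d)).

Record hopf_algebra (k : fieldType) (A : algType k) := HopfAlgebra {
  cop : {linear A -> tens A A};
  counit : {lrmorphism A -> k^o};
  antipode : {linear A -> A};
  cop1 : cop 1 = 1 \ox 1;
  copM : forall a b, cop (a * b) = tensM (cop a) (cop b);
  cop_coassoc : forall a,
    \sw_(x, y <- cop a) (x \ox cop y)
    = \sw_(x, y <- cop a) \sw_(x1, x2 <- cop x) (x1 \ox (x2 \ox y));
  counitl : forall a, \sw_(x, y <- cop a) ((counit x : k) *: y) = a;
  counitr : forall a, \sw_(x, y <- cop a) ((counit y : k) *: x) = a;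
  antipodel : forall a, \sw_(x, y <- cop a) (antipode x * y) = (counit a : k)%:A;
  antipoder : forall a, \sw_(x, y <- cop a) (x * antipode y) = (counit a : k)%:A
}.

(* Action and coaction maps on V, without axioms. *)
Record xmod_data (k : fieldType) (A : algType k) (V : lmodType k) := XmodData {
  xact : V -> A -> V;
  xcoact : V -> tens V A
}.

Section CrossedModules.
Variables (k : fieldType) (A : algType k) (H : hopf_algebra A).

Record crossed_module (V : lmodType k) (X : xmod_data A V) : Prop := CrossedModule {
  xact_bilinear : bilinear_for *:%R *:%R (xact X);
  xact1 : forall v, xact X v 1 = v;
  xactM : forall v a b, xact X v (a * b) = xact X (xact X v a) b;
  xcoact_linear : linear (xcoact X);
  xcoact_coassoc : forall v,
    \sw_(v0, a <- xcoact X v) (v0 \ox cop H a)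
    = \sw_(v0, a <- xcoact X v) \sw_(v00, v01 <- xcoact X v0) (v00 \ox (v01 \ox a));
  xcoact_counit : forall v, \sw_(v0, a <- xcoact X v) ((counit H a : k) *: v0) = v;
  xmod_compat : forall v a,
    xcoact X (xact X v a)
    = \sw_(a1, a' <- cop H a) \sw_(a2, a3 <- cop H a') \sw_(v0, v1 <- xcoact X v)
        (xact X v0 a2 \ox (antipode H a1 * v1 * a3))
}.

Definition crossed_module_map (V W : lmodType k)
    (X : xmod_data A V) (Y : xmod_data A W) (f : V -> W) : Prop :=
  (forall v a, f (xact X v a) = xact Y (f v) a) /\
  (forall v, xcoact Y (f v) = tmap f id (xcoact X v)).

(* The braiding v \ox w |-> w_0 \ox v <| w_1. *)
Definition braid (V W : lmodType k) (X : xmod_data A V) (Y : xmod_data A W)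
    (v : V) (w : W) : tens W V :=
  \sw_(w0, w1 <- xcoact Y w) (w0 \ox xact X v w1).

Definition in_Aplus : pred A := [pred a | counit H a == 0].

Fact in_Aplus_submod : submod_closed in_Aplus.
Proof.
split=> [|c a b]; rewrite !inE ?linear0 //.
by move=> /eqP ha /eqP hb; rewrite linearP /= ha hb scaler0 addr0.
Qed.
HB.instance Definition _ :=
  GRing.isSubmodClosed.Build k A in_Aplus in_Aplus_submod.

Record Aplus := MkAplus { Aplus_val : A; _ : Aplus_val \in in_Aplus }.
HB.instance Definition _ := [isSub for Aplus_val].
HB.instance Definition _ := [Choice of Aplus by <:].
HB.instance Definition _ := [SubChoice_isSubLmodule of Aplus by <:].

Lemma Aplus_act_subproof (a : Aplus) (b : A) :
  \sw_(b1, b2 <- cop H b) (antipode H b1 * \val a * b2) \in in_Aplus.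
Proof.
rewrite unfold_in /= /tlift /tsum linear_sum big1 // => p _.
by rewrite !rmorphM /= (eqP (valP a : _ \in in_Aplus)) mulr0 mul0r.
Qed.

Definition Aplus_act (a : Aplus) (b : A) : Aplus := MkAplus (Aplus_act_subproof a b).

Lemma Aplus_proj_subproof (a : A) : a - (counit H a : k)%:A \in in_Aplus.
Proof.
by rewrite unfold_in /= linearB linearZ /= rmorph1 [_ *: _]mulr1 subrr.
Qed.

Definition Aplus_proj (a : A) : Aplus := MkAplus (Aplus_proj_subproof a).

(* Delta a - 1 \ox a lies in A^+ \ox A, where it is the image of Delta a under
   the projection of A onto A^+ along 1; see [Aplus_coactE]. *)
Definition Aplus_coact (a : Aplus) : tens Aplus A := tmap Aplus_proj id (cop H (\val a)).

Definition Aplus_xmod : xmod_data A Aplus := XmodData Aplus_act Aplus_coact.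

Lemma tmap_bilinear (V V' W W' : lmodType k) (f : V -> V') (g : W -> W') :
  linear f -> linear g -> bilinear_for *:%R *:%R (fun v w => f v \ox g w).
Proof.
move=> lf lg; split=> [w a v v'|v a w w'] /=.
- by rewrite lf (tmul_bilinear _ _).1.
- by rewrite lg (tmul_bilinear _ _).2.
Qed.

Lemma Aplus_coactE (a : Aplus) :
  tmap Aplus_val id (Aplus_coact a) = cop H (\val a) - 1 \ox (\val a).
Proof.
rewrite /Aplus_coact [X in tmap _ _ X]/tmap {1}/tlift /tsum /tmap.
rewrite (big_morph _ (tlift_add _) (tlift_zero _));
  try exact: tmap_bilinear (fun c x y => erefl) (fun c x y => erefl).
rewrite (eq_bigr (fun p : A * A => p.1 \ox p.2 - 1 \ox ((counit H p.1 : k) *: p.2))).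
  rewrite sumrB -tens_sum -linear_sumr.
  by congr (_ - _ \ox _); exact: counitl.
move=> p _; rewrite tliftE.
  by rewrite /= linearBl linearZl linearZr.
exact: tmap_bilinear (fun c x y => erefl) (fun c x y => erefl).
Qed.

End CrossedModules.

(* The tensor algebra T V: its elements are formal linear combinations of words
   in V, a word w = [:: v1; ...; vn] standing for v1 \ox ... \ox vn; two
   combinations are identified when all maps that are multilinear on the words
   of each length take the same total value on them. *)
Section TensorAlgebra.
Variables (k : fieldType) (V : lmodType k).
Implicit Types (s t : seq (k * seq V)).

Definition multilinear (U : lmodType k) (F : seq V -> U) : Prop :=
  forall u w : seq V, linear (fun v : V => F (u ++ v :: w)).

Definition wsum (U : lmodType k) (F : seq V -> U) s : U :=
  \sum_(p <- s) p.1 *: F p.2.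

Definition talg_rel s t : bool :=
  `[< forall (U : lmodType k) (F : seq V -> U),
        multilinear F -> wsum F s = wsum F t >].

Lemma talg_relP s t :
  reflect (forall (U : lmodType k) (F : seq V -> U),
             multilinear F -> wsum F s = wsum F t) (talg_rel s t).
Proof. exact: asboolP. Qed.

Lemma talg_rel_refl : reflexive talg_rel.
Proof. by move=> s; apply/talg_relP. Qed.

Lemma talg_rel_sym : symmetric talg_rel.
Proof. by move=> s t; apply/talg_relP/talg_relP => h U F mF; rewrite h. Qed.

Lemma talg_rel_trans : transitive talg_rel.
Proof.
move=> s t u /talg_relP h1 /talg_relP h2; apply/talg_relP => U F mF.
by rewrite h1 // h2.
Qed.

Canonical talg_equiv := EquivRel talg_rel talg_rel_refl talg_rel_sym talg_rel_trans.

Definition talg := {eq_quot talg_rel}.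

HB.instance Definition _ : EqQuotient _ talg_rel talg := EqQuotient.on talg.
HB.instance Definition _ := Choice.on talg.

Definition tword (w : seq V) : talg := \pi_talg [:: (1, w)].
Definition tgen (v : V) : talg := tword [:: v].

(* The linear extension of F from words to T V, computed on a chosen
   representative; it is meaningful when F is multilinear, see [textE]. *)
Definition text (U : lmodType k) (F : seq V -> U) (x : talg) : U :=
  wsum F (repr x).

Lemma text_pi (U : lmodType k) (F : seq V -> U) s :
  multilinear F -> text F (\pi_talg s) = wsum F s.
Proof.
move=> mF; rewrite /text; have /eqmodP/talg_relP : repr (\pi_talg s) = s %[mod talg].
  by rewrite reprK.
exact.
Qed.

Lemma talg_eqP (x y : talg) :
  (forall (U : lmodType k) (F : seq V -> U), multilinear F -> text F x = text F y) ->
  x = y.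
Proof. by move=> h; rewrite -[x]reprK -[y]reprK; apply/eqmodP/talg_relP. Qed.

Definition talg_zero : talg := \pi_talg [::].
Definition talg_add (x y : talg) : talg := \pi_talg (repr x ++ repr y).
Definition talg_scale (a : k) (x : talg) : talg :=
  \pi_talg [seq (a * p.1, p.2) | p <- repr x].
Definition talg_opp (x : talg) : talg := talg_scale (-1) x.
Definition talg_one : talg := tword [::].
Definition talg_mul (x y : talg) : talg :=
  \pi_talg [seq (p.1 * q.1, p.2 ++ q.2) | p <- repr x, q <- repr y].

Section Ext.
Variables (U : lmodType k) (F : seq V -> U).
Hypothesis mF : multilinear F.

Lemma text_zero : text F talg_zero = 0.
Proof. by rewrite text_pi // /wsum big_nil. Qed.

Lemma text_add x y : text F (talg_add x y) = text F x + text F y.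
Proof. by rewrite text_pi // /wsum big_cat. Qed.

Lemma text_scale a x : text F (talg_scale a x) = a *: text F x.
Proof.
rewrite text_pi // /wsum big_map scaler_sumr; apply: eq_bigr => p _ /=.
by rewrite scalerA.
Qed.

Lemma text_opp x : text F (talg_opp x) = - text F x.
Proof. by rewrite text_scale scaleN1r. Qed.

Lemma textE w : text F (tword w) = F w.
Proof. by rewrite text_pi // /wsum big_seq1 scale1r. Qed.

Lemma text_mul x y :
  text F (talg_mul x y) = text (fun u => text (fun w => F (u ++ w)) y) x.
Proof.
rewrite text_pi // /wsum big_allpairs_dep; apply: eq_bigr => p _.
rewrite /text /wsum scaler_sumr; apply: eq_bigr => q _ /=.
by rewrite scalerA.
Qed.

Lemma multilinear_catl w : multilinear (fun u => F (u ++ w)).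
Proof.
by move=> u u' a x y /=; have := mF u (u' ++ w) a x y; rewrite /= -!catA.
Qed.

Lemma multilinear_catr u : multilinear (fun w => F (u ++ w)).
Proof. by move=> w w' a x y /=; rewrite !catA mF. Qed.

Lemma multilinear_text y : multilinear (fun u => text (fun w => F (u ++ w)) y).
Proof.
move=> u u' a v v' /=; rewrite /text /wsum scaler_sumr -big_split /=.
apply: eq_bigr => p _; have := multilinear_catl p.2 u u' a v v' => /= ->.
by rewrite scalerDr !scalerA mulrC.
Qed.

End Ext.

Lemma talg_addA : associative talg_add.
Proof. by move=> x y z; apply: talg_eqP => U F mF; rewrite !text_add // addrA. Qed.
Lemma talg_addC : commutative talg_add.
Proof. by move=> x y; apply: talg_eqP => U F mF; rewrite !text_add // addrC. Qed.
Lemma talg_add0 : left_id talg_zero talg_add.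
Proof. by move=> x; apply: talg_eqP => U F mF; rewrite text_add // text_zero // add0r. Qed.
Lemma talg_addN : left_inverse talg_zero talg_opp talg_add.
Proof.
by move=> x; apply: talg_eqP => U F mF; rewrite text_add // text_opp // text_zero // addNr.
Qed.

HB.instance Definition _ :=
  GRing.isZmodule.Build talg talg_addA talg_addC talg_add0 talg_addN.

Lemma talg_scaleA a c x : talg_scale a (talg_scale c x) = talg_scale (a * c) x.
Proof. by apply: talg_eqP => U F mF; rewrite !text_scale // scalerA. Qed.
Lemma talg_scale1 : left_id 1 talg_scale.
Proof. by move=> x; apply: talg_eqP => U F mF; rewrite text_scale // scale1r. Qed.
Lemma talg_scaleDr : right_distributive talg_scale +%R.
Proof.
by move=> a x y; apply: talg_eqP => U F mF; rewrite !(text_scale, text_add) // scalerDr.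
Qed.
Lemma talg_scaleDl x : {morph talg_scale^~ x : a c / a + c}.
Proof.
by move=> a c; apply: talg_eqP => U F mF; rewrite !(text_scale, text_add) // scalerDl.
Qed.

HB.instance Definition _ :=
  GRing.Zmodule_isLmodule.Build k talg talg_scaleA talg_scale1 talg_scaleDr talg_scaleDl.

Lemma eq_text (U : lmodType k) (F G : seq V -> U) x : F =1 G -> text F x = text G x.
Proof. by move=> e; apply: eq_bigr => p _; rewrite e. Qed.

Lemma textDf (U : lmodType k) (F G : seq V -> U) x :
  text (fun w => F w + G w) x = text F x + text G x.
Proof.
by rewrite /text /wsum -big_split; apply: eq_bigr => p _; rewrite scalerDr.
Qed.

Lemma textZf (U : lmodType k) a (F : seq V -> U) x :
  text (fun w => a *: F w) x = a *: text F x.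
Proof.
by rewrite /text /wsum scaler_sumr; apply: eq_bigr => p _; rewrite !scalerA mulrC.
Qed.

Lemma talg_mulA : associative talg_mul.
Proof.
move=> x y z; apply: talg_eqP => U F mF.
rewrite !text_mul //; last exact: multilinear_text.
apply: eq_text => u; rewrite text_mul; last exact: multilinear_catr.
by apply: eq_text => w; apply: eq_text => w'; rewrite catA.
Qed.
Lemma talg_mul1l : left_id talg_one talg_mul.
Proof.
by move=> x; apply: talg_eqP => U F mF; rewrite text_mul // textE //; exact: multilinear_text.
Qed.
Lemma talg_mul1r : right_id talg_one talg_mul.
Proof.
move=> x; apply: talg_eqP => U F mF; rewrite text_mul //.
apply: eq_text => u; rewrite textE ?cats0 //; exact: multilinear_catr.
Qed.
Lemma talg_mulDl : left_distributive talg_mul +%R.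
Proof.
move=> x y z; apply: talg_eqP => U F mF; rewrite [RHS]text_add // !text_mul //.
by rewrite [LHS]text_add //; exact: multilinear_text.
Qed.
Lemma talg_mulDr : right_distributive talg_mul +%R.
Proof.
move=> x y z; apply: talg_eqP => U F mF; rewrite [RHS]text_add // !text_mul //.
rewrite -textDf; apply: eq_text => u; apply: text_add; exact: multilinear_catr.
Qed.

(* The augmentation T V -> k, killing V. *)
Definition nilp_coef (w : seq V) : k^o := if w is [::] then 1 else 0.

Lemma nilp_coef_multilinear : multilinear nilp_coef.
Proof. by move=> [|x u] w a v v' /=; rewrite scaler0 addr0. Qed.

Definition tcounit : talg -> k^o := text nilp_coef.

Lemma talg_one_neq0 : talg_one != 0.
Proof.
apply/negP => /eqP /(congr1 tcounit); rewrite /tcounit.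
have mF := nilp_coef_multilinear.
by rewrite textE //= [RHS]text_zero // => /eqP; rewrite oner_eq0.
Qed.

HB.instance Definition _ := GRing.Zmodule_isNzRing.Build talg
  talg_mulA talg_mul1l talg_mul1r talg_mulDl talg_mulDr talg_one_neq0.

Lemma talg_scaleAl a (x y : talg) : a *: (x * y) = (a *: x) * y.
Proof.
apply: talg_eqP => U F mF; rewrite [LHS]text_scale // !text_mul //.
by rewrite [RHS]text_scale //; exact: multilinear_text.
Qed.
Lemma talg_scaleAr a (x y : talg) : a *: (x * y) = x * (a *: y).
Proof.
apply: talg_eqP => U F mF; rewrite [LHS]text_scale // !text_mul //.
rewrite -textZf; apply: eq_text => u; rewrite text_scale //; exact: multilinear_catr.
Qed.

HB.instance Definition _ := GRing.Lmodule_isLalgebra.Build k talg talg_scaleAl.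
HB.instance Definition _ := GRing.Lalgebra_isAlgebra.Build k talg talg_scaleAr.

Lemma text_linear (U : lmodType k) (F : seq V -> U) : multilinear F -> linear (text F).
Proof. by move=> mF a x y; rewrite [LHS]text_add // text_scale. Qed.

Lemma tcounit_linear : linear tcounit.
Proof. exact: text_linear nilp_coef_multilinear. Qed.

HB.instance Definition _ := GRing.isLinear.Build k talg k^o *:%R tcounit tcounit_linear.

Lemma tcounitM x y : tcounit (x * y) = tcounit x * tcounit y.
Proof.
have mF := nilp_coef_multilinear; rewrite /tcounit text_mul //.
rewrite [LHS]/text [text _ x in RHS]/text /wsum mulr_suml.
apply: eq_bigr => -[c [|v u]] _ /=; first by rewrite -scalerAl mul1r.
rewrite -scalerAl mul0r; congr (_ *: _).
by rewrite /text /wsum big1 // => q _; rewrite scaler0.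
Qed.

Lemma tcounit1 : tcounit 1 = 1.
Proof. by rewrite /tcounit textE //; exact: nilp_coef_multilinear. Qed.

Lemma tcounit_gen v : tcounit (tgen v) = 0.
Proof. by rewrite /tcounit textE //; exact: nilp_coef_multilinear. Qed.

Lemma tword_cons v w : tword (v :: w) = tgen v * tword w.
Proof.
apply: talg_eqP => U F mF; rewrite text_mul // !textE //.
- exact: multilinear_catr.
- exact: multilinear_text.
Qed.

Lemma tword_nil : tword [::] = 1.
Proof. by []. Qed.

(* Degree n part, and the component of even (b = false) or odd degree. *)
Definition tdeg (n : nat) (x : talg) : Prop :=
  exists s : seq (k * seq V),
    all (fun p => size p.2 == n) s /\ x = \sum_(p <- s) p.1 *: tword p.2.

Definition tpar (b : bool) : talg -> talg :=
  text (fun w => if odd (size w) == b then tword w else 0).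

End TensorAlgebra.

Arguments tcounit {k V} x.
Arguments tgen {k V} v.
Arguments tword {k V} w.

(* The structure maps of a braided-super Hopf algebra in the category of
   crossed modules (its counit and antipode play no role below). *)
Record bshopf_data (k : fieldType) (A : algType k) := BSHopfData {
  bs_alg :> algType k;
  bs_xmod : xmod_data A bs_alg;
  bs_deg : nat -> bs_alg -> Prop;
  bs_par : bool -> bs_alg -> bs_alg;
  bs_cop : bs_alg -> tens bs_alg bs_alg
}.

(* Product of the braided-super tensor square:
   (x \ox y)(z \ox w) = (-1)^{|y||z|} x Psi(y \ox z) w. *)
Definition bs_tensM (k : fieldType) (A L : algType k) (X : xmod_data A L)
    (par : bool -> L -> L) (s t : tens L L) : tens L L :=
  \sw_(x, y <- s) \sw_(z, w <- t)
    (\sum_(b : bool) \sum_(c : bool) (-1) ^+ (b && c) *: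
       \sw_(z', y' <- braid X X (par b y) (par c z)) ((x * z') \ox (y' * w))).

(* The braided-super Hopf algebra structure of T_- V.  The action and coaction
   are the ones of a module algebra and a comodule algebra,
   (x y) <| a = (x <| a_1)(y <| a_2) and (x y)_0 \ox (x y)_1 = x_0 y_0 \ox x_1 y_1;
   the coproduct is the algebra map to the braided-super tensor square with
   v |-> v \ox 1 + 1 \ox v on V. *)
Section TMinus.
Variables (k : fieldType) (A : algType k) (H : hopf_algebra A).
Variables (V : lmodType k) (X : xmod_data A V).

Fixpoint word_act (w : seq V) (a : A) : talg V :=
  if w is v :: w' then
    \sw_(a1, a2 <- cop H a) (tgen (xact X v a1) * word_act w' a2)
  else (counit H a : k)%:A.

Fixpoint word_coact (w : seq V) : tens (talg V) A :=
  if w is v :: w' then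
    \sw_(v0, v1 <- xcoact X v) \sw_(w0, w1 <- word_coact w')
      ((tgen v0 * w0) \ox (v1 * w1))
  else 1 \ox 1.

Definition talg_act (x : talg V) (a : A) : talg V := text (word_act^~ a) x.
Definition talg_coact : talg V -> tens (talg V) A := text word_coact.
Definition talg_xmod : xmod_data A (talg V) := XmodData talg_act talg_coact.

Fixpoint word_cop (w : seq V) : tens (talg V) (talg V) :=
  if w is v :: w' then
    bs_tensM talg_xmod (@tpar k V) (tgen v \ox 1 + 1 \ox tgen v) (word_cop w')
  else 1 \ox 1.

Definition talg_cop : talg V -> tens (talg V) (talg V) := text word_cop.

Lemma tcounit_act (x : talg V) a :
  tcounit (talg_act x a) = (counit H a : k) *: tcounit x.
Proof.
rewrite /talg_act [text _ x]/text /wsum linear_sum [tcounit x]/tcounit /text /wsum.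
rewrite scaler_sumr; apply: eq_bigr => -[c [|v w]] _ /=; rewrite linearZ /=.
  by rewrite linearZ /= tcounit1 !scalerA mulrC.
rewrite !scaler0 [tlift _ _]/tlift /tsum (linear_sum tcounit) big1 ?scaler0 // => p _.
by rewrite [LHS]tcounitM tcounit_gen mul0r.
Qed.

End TMinus.

Section LambdaTheta.
Variables (k : fieldType) (A : algType k) (H : hopf_algebra A).
Variables (V : lmodType k) (X : xmod_data A V) (theta : V).

Local Notation T := (talg V).
Local Notation th2 := (tgen theta ^+ 2).

(* The two-sided ideal generated by theta^2 <| a for a in A^+ and by
   [theta^2, eta] for eta in V. *)
Inductive theta_ideal : T -> Prop :=
| theta_ideal_act a : counit H a = 0 -> theta_ideal (talg_act H X th2 a)
| theta_ideal_comm eta : theta_ideal (th2 * tgen eta - tgen eta * th2)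
| theta_ideal0 : theta_ideal 0
| theta_idealD x y : theta_ideal x -> theta_ideal y -> theta_ideal (x + y)
| theta_idealMl x y : theta_ideal y -> theta_ideal (x * y)
| theta_idealMr x y : theta_ideal x -> theta_ideal (x * y).

Definition lam_rel (x y : T) : bool := `[< theta_ideal (x - y) >].

Lemma lam_relP x y : reflect (theta_ideal (x - y)) (lam_rel x y).
Proof. exact: asboolP. Qed.

Lemma theta_idealN x : theta_ideal x -> theta_ideal (- x).
Proof. by move=> h; rewrite -mulN1r; exact: theta_idealMl. Qed.

Lemma theta_idealZ a x : theta_ideal x -> theta_ideal (a *: x).
Proof. by move=> h; rewrite -mulr_algl; exact: theta_idealMl. Qed.

Lemma lam_rel_refl : reflexive lam_rel.
Proof. by move=> x; apply/lam_relP; rewrite subrr; exact: theta_ideal0. Qed.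
Lemma lam_rel_sym : symmetric lam_rel.
Proof. by move=> x y; apply/lam_relP/lam_relP => /theta_idealN; rewrite opprB. Qed.
Lemma lam_rel_trans : transitive lam_rel.
Proof.
move=> y x z /lam_relP h1 /lam_relP h2; apply/lam_relP.
by have := theta_idealD h1 h2; rewrite addrA subrK.
Qed.

Canonical lam_equiv := EquivRel lam_rel lam_rel_refl lam_rel_sym lam_rel_trans.

Definition lam := {eq_quot lam_rel}.

HB.instance Definition _ : EqQuotient _ lam_rel lam := EqQuotient.on lam.
HB.instance Definition _ := Choice.on lam.

Definition lam_pi (x : T) : lam := \pi_lam x.
Definition lam_repr (x : lam) : T := repr x.

Lemma lam_eqP x y : lam_pi x = lam_pi y <-> theta_ideal (x - y).
Proof.
split=> [h|h]; first by apply/lam_relP; apply/eqmodP; exact: h.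
by apply/eqmodP/lam_relP.
Qed.

Lemma lam_reprK x : lam_pi (lam_repr x) = x.
Proof. exact: reprK. Qed.

Lemma lam_repr_pi x : theta_ideal (lam_repr (lam_pi x) - x).
Proof. by apply/lam_eqP; exact: lam_reprK. Qed.

Definition lam_add (x y : lam) := lam_pi (lam_repr x + lam_repr y).
Definition lam_opp (x : lam) := lam_pi (- lam_repr x).
Definition lam_mul (x y : lam) := lam_pi (lam_repr x * lam_repr y).
Definition lam_scale (a : k) (x : lam) := lam_pi (a *: lam_repr x).

Lemma lam_pi_add x y : lam_add (lam_pi x) (lam_pi y) = lam_pi (x + y).
Proof.
apply/lam_eqP; rewrite opprD addrACA.
by apply: theta_idealD; exact: lam_repr_pi.
Qed.
Lemma lam_pi_opp x : lam_opp (lam_pi x) = lam_pi (- x).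
Proof. by apply/lam_eqP; rewrite -opprD; apply: theta_idealN; exact: lam_repr_pi. Qed.
Lemma lam_pi_mul x y : lam_mul (lam_pi x) (lam_pi y) = lam_pi (x * y).
Proof.
apply/lam_eqP; rewrite -(subrK (x * lam_repr (lam_pi y)) (_ * _)) -addrA -mulrBl -mulrBr.
by apply: theta_idealD; [apply: theta_idealMr | apply: theta_idealMl]; exact: lam_repr_pi.
Qed.
Lemma lam_pi_scale a x : lam_scale a (lam_pi x) = lam_pi (a *: x).
Proof. by apply/lam_eqP; rewrite -scalerBr; apply: theta_idealZ; exact: lam_repr_pi. Qed.

Lemma lamW (P : lam -> Prop) : (forall x, P (lam_pi x)) -> forall x, P x.
Proof. by move=> h x; rewrite -(lam_reprK x). Qed.

Lemma lam_addA : associative lam_add.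
Proof. by elim/lamW=> x; elim/lamW=> y; elim/lamW=> z; rewrite !lam_pi_add addrA. Qed.
Lemma lam_addC : commutative lam_add.
Proof. by elim/lamW=> x; elim/lamW=> y; rewrite !lam_pi_add addrC. Qed.
Lemma lam_add0 : left_id (lam_pi 0) lam_add.
Proof. by elim/lamW=> x; rewrite !lam_pi_add add0r. Qed.
Lemma lam_addN : left_inverse (lam_pi 0) lam_opp lam_add.
Proof. by elim/lamW=> x; rewrite lam_pi_opp !lam_pi_add addNr. Qed.

HB.instance Definition _ := GRing.isZmodule.Build lam lam_addA lam_addC lam_add0 lam_addN.

Lemma lam_scaleA a c x : lam_scale a (lam_scale c x) = lam_scale (a * c) x.
Proof. by elim/lamW: x => x; rewrite !lam_pi_scale scalerA. Qed.
Lemma lam_scale1 : left_id 1 lam_scale.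
Proof. by elim/lamW=> x; rewrite lam_pi_scale scale1r. Qed.
Lemma lam_scaleDr : right_distributive lam_scale +%R.
Proof.
move=> a; elim/lamW=> x; elim/lamW=> y.
by rewrite [_ + _]lam_pi_add !lam_pi_scale [RHS]lam_pi_add scalerDr.
Qed.
Lemma lam_scaleDl x : {morph lam_scale^~ x : a c / a + c}.
Proof.
by elim/lamW: x => x a c; rewrite !lam_pi_scale [RHS]lam_pi_add scalerDl.
Qed.

HB.instance Definition _ :=
  GRing.Zmodule_isLmodule.Build k lam lam_scaleA lam_scale1 lam_scaleDr lam_scaleDl.

Lemma lam_mulA : associative lam_mul.
Proof. by elim/lamW=> x; elim/lamW=> y; elim/lamW=> z; rewrite !lam_pi_mul mulrA. Qed.
Lemma lam_mul1l : left_id (lam_pi 1) lam_mul.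
Proof. by elim/lamW=> x; rewrite lam_pi_mul mul1r. Qed.
Lemma lam_mul1r : right_id (lam_pi 1) lam_mul.
Proof. by elim/lamW=> x; rewrite lam_pi_mul mulr1. Qed.
Lemma lam_mulDl : left_distributive lam_mul +%R.
Proof.
elim/lamW=> x; elim/lamW=> y; elim/lamW=> z.
by rewrite [_ + _]lam_pi_add !lam_pi_mul [RHS]lam_pi_add mulrDl.
Qed.
Lemma lam_mulDr : right_distributive lam_mul +%R.
Proof.
elim/lamW=> x; elim/lamW=> y; elim/lamW=> z.
by rewrite [_ + _]lam_pi_add !lam_pi_mul [RHS]lam_pi_add mulrDr.
Qed.

Lemma theta_ideal_counit x : theta_ideal x -> tcounit x = 0.
Proof.
elim=> [a h|eta||y z _ hy _ hz|y z _ hz|y z _ hy].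
- by rewrite tcounit_act h scale0r.
- by rewrite linearB /= !tcounitM tcounit_gen !mulr0 subr0 mul0r.
- exact: linear0.
- by rewrite linearD /= hy hz addr0.
- by rewrite tcounitM hz mulr0.
- by rewrite tcounitM hy mul0r.
Qed.

Lemma lam_one_neq0 : lam_pi 1 != 0.
Proof.
apply/negP => /eqP /lam_eqP; rewrite subr0 => /theta_ideal_counit /eqP.
by rewrite tcounit1 oner_eq0.
Qed.

HB.instance Definition _ := GRing.Zmodule_isNzRing.Build lam
  lam_mulA lam_mul1l lam_mul1r lam_mulDl lam_mulDr lam_one_neq0.

Lemma lam_scaleAl a (x y : lam) : a *: (x * y) = (a *: x) * y.
Proof.
elim/lamW: x => x; elim/lamW: y => y.
rewrite [_ * _ in LHS]lam_pi_mul [LHS]lam_pi_scale [_ *: _ in RHS]lam_pi_scale.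
by rewrite [RHS]lam_pi_mul scalerAl.
Qed.
Lemma lam_scaleAr a (x y : lam) : a *: (x * y) = x * (a *: y).
Proof.
elim/lamW: x => x; elim/lamW: y => y.
rewrite [_ * _ in LHS]lam_pi_mul [LHS]lam_pi_scale [_ *: _ in RHS]lam_pi_scale.
by rewrite [RHS]lam_pi_mul scalerAr.
Qed.

HB.instance Definition _ := GRing.Lmodule_isLalgebra.Build k lam lam_scaleAl.
HB.instance Definition _ := GRing.Lalgebra_isAlgebra.Build k lam lam_scaleAr.

Definition lam_gen (v : V) : lam := lam_pi (tgen v).

(* The structure of T_- descends to the quotient; it is computed on chosen
   representatives. *)
Definition lam_act (x : lam) (a : A) : lam := lam_pi (talg_act H X (lam_repr x) a).
Definition lam_coact (x : lam) : tens lam A :=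
  tmap lam_pi id (talg_coact X (lam_repr x)).
Definition lam_cop (x : lam) : tens lam lam :=
  tmap lam_pi lam_pi (talg_cop H X (lam_repr x)).
Definition lam_deg (n : nat) (x : lam) : Prop :=
  exists t : T, tdeg n t /\ x = lam_pi t.
Definition lam_par (b : bool) (x : lam) : lam := lam_pi (tpar b (lam_repr x)).

Definition Lambda_theta : bshopf_data A :=
  @BSHopfData k A lam (XmodData lam_act lam_coact) lam_deg lam_par lam_cop.

End LambdaTheta.

(* The structure maps of a strongly bicovariant differential exterior algebra:
   a graded super-bialgebra with a differential.  [ext_par] projects onto the
   parts of even (b = false) and odd (b = true) degree. *)
Record ext_data (k : fieldType) := ExtData {
  ext_space :> lmodType k;
  ext_one : ext_space;
  ext_mul : ext_space -> ext_space -> ext_space;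
  ext_deg : nat -> ext_space -> Prop;
  ext_par : bool -> ext_space -> ext_space;
  ext_cop : ext_space -> tens ext_space ext_space;
  ext_d : ext_space -> ext_space
}.

Section Smash.
Variables (k : fieldType) (A : algType k) (H : hopf_algebra A) (L : bshopf_data A).

Definition smash_mul (s t : tens A L) : tens A L :=
  \sw_(a, eta <- s) \sw_(b, zeta <- t) \sw_(b1, b2 <- cop H b)
    ((a * b1) \ox (xact (bs_xmod L) eta b2 * zeta)).

Definition smash_cop (s : tens A L) : tens (tens A L) (tens A L) :=
  \sw_(a, eta <- s) \sw_(a1, a2 <- cop H a) \sw_(eta1, eta2 <- bs_cop eta)
    \sw_(eta10, eta11 <- xcoact (bs_xmod L) eta1)
      ((a1 \ox eta10) \ox ((a2 * eta11) \ox eta2)).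

Definition smash_deg (n : nat) (s : tens A L) : Prop :=
  exists r : seq (A * L),
    (forall p, p \in r -> bs_deg n p.2) /\ s = \sum_(p <- r) (p.1 \ox p.2).

Definition smash_par (b : bool) : tens A L -> tens A L := tmap id (@bs_par _ _ L b).

End Smash.

(* [x, y} = x y - (-1)^{|x||y|} y x, extended bilinearly. *)
Definition scomm (k : fieldType) (W : lmodType k) (mul : W -> W -> W)
    (par : bool -> W -> W) (x y : W) : W :=
  \sum_(b : bool) \sum_(c : bool)
    (mul (par b x) (par c y) - (-1) ^+ (b && c) *: mul (par c y) (par b x)).

Definition graded_central (k : fieldType) (E : ext_data k) (x : E) : Prop :=
  forall y : E, scomm (@ext_mul k E) (@ext_par k E) x y = 0.

(* x |-> (-1)^{|x|} x *)
Definition ext_sgn (k : fieldType) (E : ext_data k) (x : E) : E :=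
  ext_par false x - ext_par true x.

Record augmentation (k : fieldType) (E : ext_data k) (i : {linear E -> E}) : Prop :=
  Augmentation {
  aug_deg : forall n x, ext_deg n.+1 x -> ext_deg n (i x);
  aug_deg0 : forall x, ext_deg 0 x -> i x = 0;
  aug_square : forall x, i (i x) = 0;
  aug_der : forall x y,
    i (ext_mul x y) = ext_mul (i x) y + ext_mul (ext_sgn x) (i y);
  aug_coder : forall x,
    ext_cop (i x) = tmap i id (ext_cop x) + tmap (@ext_sgn k E) i (ext_cop x)
}.

Section OmegaTheta.
Variables (k : fieldType) (A : algType k) (H : hopf_algebra A).
Variables (V : lmodType k) (X : xmod_data A V) (theta : V).

Local Notation L := (Lambda_theta H X theta).

Definition Omega0 (a : A) : tens A L := a \ox (1 : lam H X theta).
Definition Omega1 (a : A) (v : V) : tens A L := a \ox lam_gen H X theta v.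

Definition Omega_theta : ext_data k :=
  @ExtData k (tens A L) (Omega0 1) (smash_mul H (L := L)) (smash_deg (L := L))
    (smash_par (L := L)) (smash_cop H (L := L))
    (scomm (smash_mul H (L := L)) (smash_par (L := L)) (Omega1 1 theta)).

Definition augmented_by (i : V -> A) : Prop :=
  exists I : {linear Omega_theta -> Omega_theta},
    augmentation I /\ forall a v, I (Omega1 a v) = Omega0 (a * i v).

End OmegaTheta.

(* Main.v *)
(* The augmentation i must be the super-derivation of Omega = A # Lambda_theta
   that vanishes on A and extends i.  Applied to theta^2, it gives
   i(theta) theta - theta i(theta) = - theta <| i(theta), because colinearity
   makes i(theta) primitive.  As theta^2 is central, applying i to
   theta^2 y = y theta^2 shows that theta <| i(theta) is graded central.
   Conversely, an algebra map Omega -> B amounts to an algebra map j : A -> B and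
   a linear map f : V -> B with f(v) j(a) = j(a_1) f(v <| a_2) such that f(theta)^2
   commutes with the images of j and f.  With B the skew extension of Omega by
   itself this constructs the super-derivation i, its last condition being graded
   centrality.  With B the super tensor square of Omega it identifies the coproduct
   as an algebra map, so that the super-coderivation property and i^2 = 0 only
   have to be checked on A and V. *)
Require Import Defs.
From HB Require Import structures.
From mathcomp Require Import all_boot all_order all_algebra sesquilinear.

Set Implicit Arguments.
Unset Strict Implicit.
Unset Printing Implicit Defensive.

Import GRing.Theory.
Local Open Scope ring_scope.

(** * Linearity and Sweedler sums *)

(** For a pair (j, f) with linear extension F of f to the tensor algebra, the antipode inverts the
    cross relation: F(x <| a) = j(S a_1) F(x) j(a_2). Hence a square f(theta)^2 that commutes with j
    satisfies the relations theta^2 <| a by itself, and all relations come down to one commuting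
    element. In the skew extension it is (theta^2, - theta <| i(theta)), where the second component
    brings in graded centrality. In the super tensor square it is theta^2 \ox 1 + 1 \ox theta^2,
    because theta is invariant and the cross terms cancel by the Koszul sign. The obstacle is that
    action, parity, coaction and coproduct of [Lambda_theta] are computed on chosen representatives,
    so each has to be shown to respect the ideal. For the action and the parity this is checked on
    the generators of the ideal. For the coproduct and the coaction the braided-super square of the
    tensor algebra is mapped to the super square of Omega instead: there the coproduct becomes an
    algebra map that kills the ideal, and counits recover both structure maps from it. *)

Local Notation bilin b := (bilinear_for *:%R *:%R b).

Section Linear.
Variable k : fieldType.
Implicit Types U V W Z : lmodType k.

Lemma lin_id U : linear (fun x : U => x).
Proof. by []. Qed.

Lemma lin_comp U V W (f : V -> W) (h : U -> V) :
  linear f -> linear h -> linear (fun x => f (h x)).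
Proof. by move=> lf lh a x y; rewrite lh lf. Qed.

Lemma lin_fun V W (f : {linear V -> W}) : linear f.
Proof. by move=> a x y; rewrite linearP. Qed.

Lemma lin_add U V (f g : U -> V) : linear f -> linear g -> linear (fun x => f x + g x).
Proof. by move=> lf lg a x y; rewrite lf lg scalerDr addrACA. Qed.

Lemma lin_opp U V (f : U -> V) : linear f -> linear (fun x => - f x).
Proof. by move=> lf a x y; rewrite lf opprD scalerN. Qed.

Lemma lin_zero U V : linear (fun _ : U => 0 : V).
Proof. by move=> a x y; rewrite scaler0 addr0. Qed.

Lemma lin_scale U V c (f : U -> V) : linear f -> linear (fun x => c *: f x).
Proof. by move=> lf a x y; rewrite lf scalerDr !scalerA mulrC. Qed.

Lemma lin_scalel U V (f : U -> k^o) (v : V) :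
  linear f -> linear (fun x => (f x : k) *: v).
Proof. by move=> lf a x y; rewrite lf scalerDl scalerA. Qed.

Lemma lin_sum U V (I : Type) (r : seq I) (f : I -> U -> V) :
  (forall i, linear (f i)) -> linear (fun x => \sum_(i <- r) f i x).
Proof.
move=> lf a x y; rewrite scaler_sumr -big_split; apply: eq_bigr => i _.
exact: lf.
Qed.

Lemma lin_mull (R : algType k) U (f : U -> R) (c : R) :
  linear f -> linear (fun x => f x * c).
Proof. by move=> lf a x y; rewrite lf mulrDl -scalerAl. Qed.

Lemma lin_mulr (R : algType k) U (f : U -> R) (c : R) :
  linear f -> linear (fun x => c * f x).
Proof. by move=> lf a x y; rewrite lf mulrDr -scalerAr. Qed.

Lemma bilP U V W (b : U -> V -> W) :
  (forall w, linear (fun v => b v w)) -> (forall v, linear (fun w => b v w)) -> bilin b.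
Proof. by move=> l r; split=> [w a v v'|v a w w']; [exact: l | exact: r]. Qed.

Lemma lin_bill U V W Z (b : U -> V -> W) (h : Z -> U) c :
  bilin b -> linear h -> linear (fun x => b (h x) c).
Proof. by move=> [bb _] lh a x y; rewrite lh; exact: bb. Qed.

Lemma lin_bilr U V W Z (b : U -> V -> W) (h : Z -> V) c :
  bilin b -> linear h -> linear (fun x => b c (h x)).
Proof. by move=> [_ bb] lh a x y; rewrite lh; exact: bb. Qed.

Lemma lin_tmull U V W (h : U -> V) (c : W) : linear h -> linear (fun x => h x \ox c).
Proof. by move=> lh; exact: (lin_bill _ (@tmul_bilinear k V W) lh). Qed.

Lemma lin_tmulr U V W (h : U -> W) (c : V) : linear h -> linear (fun x => c \ox h x).
Proof. by move=> lh; exact: (lin_bilr _ (@tmul_bilinear k V W) lh). Qed.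

Lemma lin_tlift U V W Z (h : Z -> tens U V) (b : U -> V -> W) :
  bilin b -> linear h -> linear (fun x => tlift (h x) b).
Proof. by move=> bb lh; exact: (lin_comp (tlift_linear bb) lh). Qed.

Lemma lin_tliftr U V W Z (t : tens U V) (b : Z -> U -> V -> W) :
  (forall u v, linear (fun x => b x u v)) -> linear (fun x => tlift t (b x)).
Proof. by move=> lb; apply: (@lin_sum _ _ _ _ (fun p x => b x p.1 p.2)) => p. Qed.

Lemma linD U V (f : U -> V) : linear f -> {morph f : x y / x + y}.
Proof. by move=> lf x y; rewrite -[x in LHS]scale1r lf scale1r. Qed.

Lemma lin0 U V (f : U -> V) : linear f -> f 0 = 0.
Proof. by move=> lf; apply: (addrI (f 0)); rewrite -(linD lf) !addr0. Qed.

Lemma linZ U V (f : U -> V) : linear f -> forall a x, f (a *: x) = a *: f x.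
Proof. by move=> lf a x; rewrite -[_ *: _]addr0 lf (lin0 lf) addr0. Qed.

Lemma linN U V (f : U -> V) : linear f -> forall x, f (- x) = - f x.
Proof. by move=> lf x; rewrite -scaleN1r (linZ lf) scaleN1r. Qed.

Lemma linB U V (f : U -> V) : linear f -> {morph f : x y / x - y}.
Proof. by move=> lf x y; rewrite (linD lf) (linN lf). Qed.

Lemma linS U V (f : U -> V) : linear f ->
  forall (I : Type) (r : seq I) (P : pred I) (F : I -> U),
  f (\sum_(i <- r | P i) F i) = \sum_(i <- r | P i) f (F i).
Proof. by move=> lf I r P F; exact: (big_morph f (linD lf) (lin0 lf)). Qed.

Lemma tmap_lin (V V' W W' : lmodType k) (f : V -> V') (g : W -> W') :
  linear f -> linear g -> linear (tmap f g).
Proof. by move=> lf lg; apply: tlift_linear; exact: tmap_bilinear. Qed.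

Lemma counit_lin (A : algType k) (H : hopf_algebra A) : linear (counit H : A -> k^o).
Proof. by move=> a x y; rewrite linearP. Qed.

End Linear.

(* Proves linearity and bilinearity side conditions.  It dispatches on the head
   symbol of the body: plain unification against the closure lemmas would unfold
   definitions in search of a match. *)
Ltac lin :=
  cbv beta;
  lazymatch goal with
  | |- bilinear_for _ _ ?b =>
      first [ assumption | exact: tmul_bilinear
            | solve [match goal with h : forall _, _ |- _ => refine (h _) end]
            | apply: bilP; lin ]
  | |- forall _, _ => let x := fresh in intro x; lin
  | |- GRing.linear_for _ ?f =>
      first
      [ assumption
      | match goal with h : forall _, _ |- _ =>
          solve [refine (h _) | refine (h _ _) | refine (h _ _ _)] end
      | lin_body f
      | refine (@counit_lin _ _ _)
      | refine (lin_comp (@counit_lin _ _ _) _); lin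
      | refine (lin_fun _)
      | match goal with
        | h : bilinear_for _ _ ?b |- _ =>
            first [ refine (lin_bill _ h _); lin | refine (lin_bilr _ h _); lin ]
        | h : GRing.linear_for _ ?g |- _ => refine (lin_comp h _); lin
        | h : forall _, GRing.linear_for _ _ |- _ => refine (lin_comp (h _) _); lin
        end ]
  end
with lin_body f :=
  lazymatch f with
  | fun x => x => refine (@lin_id _ _)
  | fun _ => ?c => exact: lin_zero
  | fun x => tlift (@?t x) (@?b x) =>
      lazymatch b with
      | fun _ => ?c => refine (lin_tlift _ _); lin
      | _ => refine (lin_tliftr _ _); lin
      end
  | fun x => tmul (@?t x) (@?b x) =>
      lazymatch b with
      | fun _ => ?c => refine (lin_tmull _ _); lin
      | _ => refine (lin_tmulr _ _); lin
      end
  | fun x => GRing.mul (@?t x) (@?b x) =>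
      lazymatch b with
      | fun _ => ?c => refine (lin_mull _ _); lin
      | _ => refine (lin_mulr _ _); lin
      end
  | fun x => GRing.scale (@?t x) (@?b x) =>
      lazymatch b with
      | fun _ => ?c => refine (lin_scalel _ _); lin
      | _ => refine (lin_scale _ _); lin
      end
  | fun x => Algebra.add (@?t x) (@?b x) => refine (lin_add _ _); lin
  | fun x => Algebra.opp (@?t x) => refine (lin_opp _); lin
  | fun x => GRing.Linear.sort ?F (@?t x) => refine (lin_comp (lin_fun F) _); lin
  | fun x => tmap _ _ (@?t x) => refine (lin_comp (tmap_lin _ _) _); lin
  | GRing.mul ?c => refine (lin_mulr _ (@lin_id _ _))
  | tmul ?c => refine (lin_tmulr _ (@lin_id _ _))
  | GRing.scale ?c => refine (lin_scale _ (@lin_id _ _))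
  | fun x => bigop.body _ _ _ => refine (lin_sum _ _); lin
  end.

(** * Sums over the legs of a tensor *)

Section Tens.
Variable k : fieldType.
Implicit Types U V W Z : lmodType k.

Lemma eq_sw V W U (t : tens V W) (b c : V -> W -> U) :
  (forall v w, b v w = c v w) -> tlift t b = tlift t c.
Proof. by move=> e; apply: eq_bigr => p _. Qed.

Lemma sw_lin V W U Z (f : U -> Z) (t : tens V W) (b : V -> W -> U) :
  linear f -> f (tlift t b) = \sw_(v, w <- t) f (b v w).
Proof. by move=> lf; apply: linS. Qed.

Lemma sw_mulr (R : algType k) V W (t : tens V W) (b : V -> W -> R) c :
  c * tlift t b = \sw_(v, w <- t) (c * b v w).
Proof. by rewrite (sw_lin (f := fun x => c * x)) //; lin. Qed.

Lemma sw_mull (R : algType k) V W (t : tens V W) (b : V -> W -> R) c :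
  tlift t b * c = \sw_(v, w <- t) (b v w * c).
Proof. by rewrite (sw_lin (f := fun x => x * c)) //; lin. Qed.

Lemma sw_scale V W U (t : tens V W) (b : V -> W -> U) c :
  c *: tlift t b = \sw_(v, w <- t) (c *: b v w).
Proof. by rewrite (sw_lin (f := fun x => c *: x)) //; lin. Qed.

Lemma sw_bill V W U Z Z' (t : tens V W) (b : V -> W -> U) (f : U -> Z -> Z') c :
  bilin f -> f (tlift t b) c = \sw_(v, w <- t) f (b v w) c.
Proof. by move=> bf; rewrite (sw_lin (f := fun x => f x c)) //; lin. Qed.

Lemma sw_bilr V W U Z Z' (t : tens V W) (b : V -> W -> U) (f : Z -> U -> Z') c :
  bilin f -> f c (tlift t b) = \sw_(v, w <- t) f c (b v w).
Proof. by move=> bf; rewrite (sw_lin (f := fun x => f c x)) //; lin. Qed.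

Lemma swE V W U (b : V -> W -> U) v w : bilin b -> tlift (v \ox w) b = b v w.
Proof. exact: tliftE. Qed.

Lemma swD V W U (b : V -> W -> U) s t :
  bilin b -> tlift (s + t) b = tlift s b + tlift t b.
Proof. move=> bb; exact: (linD (tlift_linear bb)). Qed.

Lemma sw_sw V W V' W' U (t : tens V W) (c : V -> W -> tens V' W') (b : V' -> W' -> U) :
  bilin b -> tlift (tlift t c) b = \sw_(v, w <- t) tlift (c v w) b.
Proof. by move=> bb; apply: (sw_lin (f := fun s => tlift s b)); exact: tlift_linear. Qed.

Lemma sw_exch V W V' W' U (s : tens V W) (t : tens V' W') (b : V -> W -> V' -> W' -> U) :
  \sw_(v, w <- s) \sw_(v', w' <- t) b v w v' w' =
  \sw_(v', w' <- t) \sw_(v, w <- s) b v w v' w'.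
Proof. exact: exchange_big. Qed.

Lemma swDr V W U (t : tens V W) (b c : V -> W -> U) :
  \sw_(v, w <- t) (b v w + c v w) = tlift t b + tlift t c.
Proof. exact: big_split. Qed.

Lemma sw_sum V W U (I : Type) (r : seq I) (t : tens V W) (b : I -> V -> W -> U) :
  \sw_(v, w <- t) \sum_(i <- r) b i v w = \sum_(i <- r) \sw_(v, w <- t) b i v w.
Proof. exact: exchange_big. Qed.

Lemma sw0 V W U (t : tens V W) (b : V -> W -> U) :
  (forall v w, b v w = 0) -> tlift t b = 0.
Proof. by move=> e; apply: big1 => p _; apply: e. Qed.

Lemma sw_tens V W (t : tens V W) : \sw_(v, w <- t) (v \ox w) = t.
Proof. by rewrite [RHS]tens_sum. Qed.

Lemma tens_ext V W U (f g : tens V W -> U) : linear f -> linear g ->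
  (forall v w, f (v \ox w) = g (v \ox w)) -> forall t, f t = g t.
Proof.
by move=> lf lg e t; rewrite [t]tens_sum (linS lf) (linS lg); apply: eq_bigr.
Qed.

Lemma tens_ind V W (P : tens V W -> Prop) :
  (forall c s t, P s -> P t -> P (c *: s + t)) ->
  (forall v w, P (v \ox w)) -> forall t, P t.
Proof.
move=> hD hM t; rewrite [t]tens_sum.
have h0 : P 0 by have := hD (-1) _ _ (hM 0 0) (hM 0 0); rewrite scaleN1r addNr.
elim: (repr t) => [|p r IH]; first by rewrite big_nil.
by rewrite big_cons -[_ \ox _]scale1r; apply: hD.
Qed.

Lemma tmapE V V' W W' (f : V -> V') (g : W -> W') v w :
  linear f -> linear g -> tmap f g (v \ox w) = f v \ox g w.
Proof. by move=> lf lg; rewrite /tmap tliftE //; exact: tmap_bilinear. Qed.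

Lemma sw_tmap V V' W W' U (f : V -> V') (g : W -> W') (b : V' -> W' -> U) t :
  bilin b -> tlift (tmap f g t) b = \sw_(v, w <- t) b (f v) (g w).
Proof. by move=> bb; rewrite sw_sw //; apply: eq_sw => v w; rewrite swE. Qed.

End Tens.

(** * Sweedler rules in a Hopf algebra *)

Section Hopf.
Variables (k : fieldType) (A : algType k) (H : hopf_algebra A).
Implicit Type U : lmodType k.

Lemma sw_copM U (g : A -> A -> U) a b : bilin g ->
  tlift (cop H (a * b)) g =
  \sw_(a1, a2 <- cop H a) \sw_(b1, b2 <- cop H b) g (a1 * b1) (a2 * b2).
Proof.
move=> bg; rewrite copM /tensM sw_sw //; apply: eq_sw => a1 a2.
by rewrite sw_sw //; apply: eq_sw => b1 b2; rewrite swE.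
Qed.

Lemma sw_cop1 U (g : A -> A -> U) : bilin g -> tlift (cop H 1) g = g 1 1.
Proof. by move=> bg; rewrite cop1 swE. Qed.

(** Coassociativity tested against a trilinear map: this is how the legs of iterated coproducts are
    rebracketed throughout. *)
Lemma sw_coassoc U (g : A -> A -> A -> U) a :
  (forall y z, linear (fun x => g x y z)) -> (forall x z, linear (fun y => g x y z)) ->
  (forall x y, linear (fun z => g x y z)) ->
  \sw_(x, y <- cop H a) \sw_(y1, y2 <- cop H y) g x y1 y2 =
  \sw_(x, y <- cop H a) \sw_(x1, x2 <- cop H x) g x1 x2 y.
Proof.
move=> l1 l2 l3.
have /(congr1 (fun t => \sw_(x, s <- t) \sw_(y, z <- s) g x y z)) := cop_coassoc H a.
have bg x : bilin (g x) by lin.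
have bG : bilin (fun x s => \sw_(y, z <- s) g x y z) by lin.
rewrite !sw_sw // => E.
transitivity (\sw_(x, y <- cop H a)
    tlift (x \ox cop H y) (fun x s => \sw_(y, z <- s) g x y z)).
  by apply: eq_sw => x y; rewrite swE.
rewrite E; apply: eq_sw => x y; rewrite sw_sw //.
by apply: eq_sw => x1 x2; rewrite swE // swE.
Qed.

Lemma sw_counitl U (f : A -> U) a : linear f ->
  \sw_(x, y <- cop H a) ((counit H x : k) *: f y) = f a.
Proof.
move=> lf; rewrite -[in RHS](counitl H a) (sw_lin _ _ lf).
by apply: eq_sw => x y; rewrite (linZ lf).
Qed.

Lemma sw_counitr U (f : A -> U) a : linear f ->
  \sw_(x, y <- cop H a) ((counit H y : k) *: f x) = f a.
Proof.
move=> lf; rewrite -[in RHS](counitr H a) (sw_lin _ _ lf).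
by apply: eq_sw => x y; rewrite (linZ lf).
Qed.

Lemma sw_antipodel U (f : A -> U) a : linear f ->
  \sw_(x, y <- cop H a) f (antipode H x * y) = (counit H a : k) *: f 1.
Proof. by move=> lf; rewrite -(linZ lf) -antipodel (sw_lin _ _ lf). Qed.

Lemma sw_antipoder U (f : A -> U) a : linear f ->
  \sw_(x, y <- cop H a) f (x * antipode H y) = (counit H a : k) *: f 1.
Proof. by move=> lf; rewrite -(linZ lf) -antipoder (sw_lin _ _ lf). Qed.

End Hopf.

(** * Actions and coactions on the tensor algebra *)

Section TensorAlgebra.
Variables (k : fieldType) (V : lmodType k).
Implicit Type U : lmodType k.
Local Notation T := (talg V).

Lemma talg_sum (x : T) : x = \sum_(p <- repr x) p.1 *: tword p.2.
Proof.
apply: talg_eqP => U F mF; rewrite {1}/text /wsum (linS (text_linear mF)).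
by apply: eq_bigr => p _; rewrite (linZ (text_linear mF)) textE.
Qed.

Lemma talg_ext U (f g : T -> U) : linear f -> linear g ->
  (forall w, f (tword w) = g (tword w)) -> forall x, f x = g x.
Proof.
move=> lf lg e x; rewrite [x]talg_sum (linS lf) (linS lg); apply: eq_bigr => p _.
by rewrite (linZ lf) (linZ lg) e.
Qed.

Lemma talg_ind (P : T -> Prop) :
  (forall c x y, P x -> P y -> P (c *: x + y)) -> P 1 ->
  (forall v x, P x -> P (tgen v * x)) -> forall x, P x.
Proof.
move=> hD h1 hM x; rewrite [x]talg_sum.
have h0 : P 0 by have := hD (-1) _ _ h1 h1; rewrite scaleN1r addNr.
elim: (repr x) => [|p r IH]; first by rewrite big_nil.
rewrite big_cons; apply: hD => //; elim: p.2 => [|v w IHw] //.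
by rewrite tword_cons; apply: hM.
Qed.

(** The index i varies in the induction hypothesis because acting by a calls it at the leg a_2, and
    moving [tpar] past a generator flips the parity. It is [unit] where nothing varies. *)
Lemma talg_eq_ind (I : Type) U (f g : I -> T -> U) :
  (forall i, linear (f i)) -> (forall i, linear (g i)) ->
  (forall i, f i 1 = g i 1) ->
  (forall v x, (forall i, f i x = g i x) -> forall i, f i (tgen v * x) = g i (tgen v * x)) ->
  forall i x, f i x = g i x.
Proof.
move=> lf lg e1 eM i x; move: x i; apply: talg_ind => // c x y hx hy i.
by rewrite lf lg hx hy.
Qed.

Section Recursion.
Variables (U : lmodType k) (F : seq V -> U) (G : V -> U -> U).
Hypotheses (bG : bilin G) (FG : forall v w, F (v :: w) = G v (F w)).

Lemma multilinear_rec : multilinear F.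
Proof.
by elim=> [|u1 u IH] w a v v' /=; rewrite !FG; [exact: bG.1 | rewrite IH; exact: bG.2].
Qed.

(** Turns a recursion on words into one on T V; the coaction, the coproduct and the extension of f
    to an algebra map are all folds of this kind. *)
Lemma text_rec v x : text F (tgen v * x) = G v (text F x).
Proof.
have lF := text_linear multilinear_rec.
move: x; apply: talg_ext => [||w]; [by lin | by lin |].
by rewrite -tword_cons !textE //; exact: multilinear_rec.
Qed.

End Recursion.

Lemma tgen_lin : linear (@tgen k V).
Proof.
move=> a v v'; apply: talg_eqP => U F mF.
by rewrite (text_linear mF) /tgen !textE // -(mF [::] [::]).
Qed.

Lemma tpar_mult b : multilinear (fun w : seq V => if odd (size w) == b then tword w else 0).
Proof.
have mtw : multilinear (@tword k V).
  by apply: (@multilinear_rec _ _ (fun v x => tgen v * x)) => [|v w];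
    [have := tgen_lin; lin | exact: tword_cons].
move=> u w a v v'; rewrite !size_cat /=; case: ifP => _; first exact: mtw.
by rewrite scaler0 addr0.
Qed.

Lemma tpar_lin b : linear (@tpar k V b).
Proof. exact: text_linear (tpar_mult b). Qed.

Lemma tpar_word b w : tpar b (tword w) = if odd (size w) == b then tword w else 0 :> T.
Proof. exact: textE (tpar_mult b) w. Qed.

Lemma tpar1 b : tpar b (1 : T) = if b then 0 else 1.
Proof. by rewrite (tpar_word b [::]); case: b. Qed.

Lemma tpar_cons b v (x : T) : tpar b (tgen v * x) = tgen v * tpar (~~ b) x.
Proof.
move: x; have lp := tpar_lin; apply: talg_ext => [||w]; [by lin | by lin |].
by rewrite -tword_cons !tpar_word /=; case: odd b => -[]; rewrite ?mulr0 ?tword_cons.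
Qed.

Lemma tpar_gen b v : tpar b (tgen v) = (if b then tgen v else 0) :> T.
Proof. by rewrite -[tgen v]mulr1 tpar_cons tpar1; case: b; rewrite /= ?mulr0. Qed.

Lemma tpar_sum (x : T) : tpar false x + tpar true x = x.
Proof.
have lp := tpar_lin; move: x; apply: talg_ext => [||w]; [by lin | by lin |].
by rewrite !tpar_word; case: odd; rewrite /= ?addr0 ?add0r.
Qed.

Lemma tpar_par b c (x : T) : tpar b (tpar c x) = if b == c then tpar b x else 0.
Proof.
have lp := tpar_lin; move: x; apply: talg_ext => [||w]; [by lin | by case: eqP => _; lin |].
rewrite !tpar_word; case oc: (odd _ == c); rewrite ?(lin0 (lp _)) ?tpar_word //=;
  by move: (odd _) oc => o; case: b c o => [] [] [].
Qed.

Lemma tpar_mul b c (x y : T) : tpar b (x * tpar c y) = tpar (b (+) c) x * tpar c y.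
Proof.
have lp := tpar_lin; move: b x.
apply: talg_eq_ind => [b|b|b|v x IH b]; [by lin | by lin | |].
  by rewrite mul1r tpar1 tpar_par; case: b; case: c; rewrite /= ?mul0r ?mul1r.
by rewrite -mulrA !tpar_cons IH mulrA addNb.
Qed.

End TensorAlgebra.

(** * Sweedler rules for a coaction *)

Section Coaction.
Variables (k : fieldType) (A : algType k) (H : hopf_algebra A).
Variables (V : lmodType k) (delta : V -> tens V A).

(** Coassociativity is assumed at the single element v, so that an induction hypothesis on T V can
    be fed in as well as the axiom on V. *)
Lemma sw_xcoassoc (U : lmodType k) (g : V -> A -> A -> U) v :
  linear (delta) ->
  \sw_(v0, a <- delta v) (v0 \ox cop H a)
    = \sw_(v0, a <- delta v) \sw_(v00, v01 <- delta v0) (v00 \ox (v01 \ox a)) ->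
  (forall y z, linear (fun x => g x y z)) -> (forall x z, linear (fun y => g x y z)) ->
  (forall x y, linear (fun z => g x y z)) ->
  \sw_(v0, a <- delta v) \sw_(a1, a2 <- cop H a) g v0 a1 a2 =
  \sw_(v0, a <- delta v) \sw_(v00, v01 <- delta v0) g v00 v01 a.
Proof.
move=> lX + l1 l2 l3.
have bg x : bilin (g x) by lin.
have bG : bilin (fun x s => \sw_(y, z <- s) g x y z) by lin.
move=> /(congr1 (fun t => \sw_(x, s <- t) \sw_(y, z <- s) g x y z)).
rewrite !sw_sw // => E.
transitivity (\sw_(v0, a <- delta v)
    tlift (v0 \ox cop H a) (fun x s => \sw_(y, z <- s) g x y z)).
  by apply: eq_sw => x y; rewrite swE.
rewrite E; apply: eq_sw => x y; rewrite sw_sw //.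
by apply: eq_sw => x1 x2; rewrite swE // swE.
Qed.

Lemma sw_xcounit (U : lmodType k) (f : V -> U) v :
  \sw_(v0, a <- delta v) ((counit H a : k) *: v0) = v -> linear f ->
  \sw_(v0, a <- delta v) ((counit H a : k) *: f v0) = f v.
Proof.
move=> e lf; rewrite -[in RHS]e (sw_lin _ _ lf).
by apply: eq_sw => x y; rewrite (linZ lf).
Qed.

End Coaction.

(** * The tensor algebra as a module algebra and comodule algebra *)

Section TensorXmod.
Variables (k : fieldType) (A : algType k) (H : hopf_algebra A).
Variables (V : lmodType k) (X : xmod_data A V) (crossedV : crossed_module H X).
Local Notation T := (talg V).
Local Notation act := (talg_act H X).
Local Notation coact := (talg_coact X).

Let bX : bilin (xact X) := xact_bilinear crossedV.
Let lX : linear (xcoact X) := xcoact_linear crossedV.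
Let lgen := @tgen_lin k V.

Lemma word_act_lin w : linear (word_act H X w).
Proof. by elim: w => [|v w IH] /=; lin. Qed.

Lemma word_act_mult a : multilinear (fun w => word_act H X w a).
Proof.
move=> u w; elim: u a => [|u1 u IH] a /=; have lw := word_act_lin; lin.
Qed.

Lemma talg_act_bilin : bilin act.
Proof.
apply: bilP => [a|x]; first exact: text_linear (word_act_mult a).
by apply: (@lin_sum _ _ _ _ _ (fun p a => p.1 *: word_act H X p.2 a)) => p;
  have lw := word_act_lin; lin.
Qed.
Let bact := talg_act_bilin.

Lemma talg_act1 a : act 1 a = (counit H a : k)%:A.
Proof. exact: textE (word_act_mult a) [::]. Qed.

Lemma talg_act_cons v x a :
  act (tgen v * x) a = \sw_(a1, a2 <- cop H a) (tgen (xact X v a1) * act x a2).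
Proof.
move: x; apply: talg_ext => [||w]; [by lin | by lin |].
rewrite -tword_cons /talg_act (textE (word_act_mult a)); apply: eq_sw => a1 a2.
by rewrite (textE (word_act_mult a2)).
Qed.

Lemma talg_act_gen v a : act (tgen v) a = tgen (xact X v a).
Proof.
rewrite -[tgen v]mulr1 talg_act_cons.
under eq_sw do rewrite talg_act1 -scalerAr mulr1.
by rewrite (sw_counitr H); last by lin.
Qed.

Lemma talg_actM x y a :
  act (x * y) a = \sw_(a1, a2 <- cop H a) (act x a1 * act y a2).
Proof.
move: a x; apply: talg_eq_ind => [a|a|a|v x IH a]; [by lin | by lin | |].
  under eq_sw do rewrite talg_act1 -scalerAl mul1r.
  by rewrite mul1r (sw_counitl H); last by lin.
rewrite -mulrA talg_act_cons.
under eq_sw => a1 a2 do rewrite IH sw_mulr.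
rewrite (sw_coassoc H); try by lin.
apply: eq_sw => a1 a2; rewrite talg_act_cons sw_mull.
by apply: eq_sw => a3 a4; rewrite mulrA.
Qed.

Lemma talg_act_id x : act x 1 = x.
Proof.
move: x; apply: (talg_eq_ind (I := unit) (f := fun _ x => act x 1) (g := fun _ x => x)) => //.
- by move=> _; lin.
- by move=> _; rewrite talg_act1 rmorph1 scale1r.
move=> v x IH _; rewrite talg_act_cons sw_cop1; last by lin.
by rewrite (IH tt) (xact1 crossedV).
Qed.

Lemma talg_act_comp x a b : act x (a * b) = act (act x a) b.
Proof.
(* Both a and b get split by the coproduct, so they are packed into one index for [talg_eq_ind]. *)
suff E (p : A * A) y : act y (p.1 * p.2) = act (act y p.1) p.2 by exact: (E (a, b)).
move: p y; apply: talg_eq_ind => [p|p|[{}a {}b]|v {}x IH [{}a {}b]] /=; [by lin | by lin | |].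
  by rewrite !talg_act1 rmorphM /= (linZ (lin_bill b bact (@lin_id _ _))) talg_act1 scalerA.
rewrite !talg_act_cons sw_copM; last by lin.
rewrite (sw_bill _ _ _ bact).
apply: eq_sw => a1 a2; rewrite talg_act_cons; apply: eq_sw => b1 b2.
by rewrite (xactM crossedV) -(IH (_, _)).
Qed.

Let coact_step (v : V) (t : tens T A) : tens T A :=
  \sw_(v0, v1 <- xcoact X v) \sw_(w0, w1 <- t) ((tgen v0 * w0) \ox (v1 * w1)).

Let coact_step_bilin : bilin coact_step.
Proof. by rewrite /coact_step; lin. Qed.

Let word_coact_mult : multilinear (word_coact X).
Proof. exact: (multilinear_rec coact_step_bilin). Qed.

Lemma talg_coact_lin : linear coact.
Proof. exact: text_linear word_coact_mult. Qed.
Let lcoact := talg_coact_lin.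

Lemma talg_coact1 : coact 1 = 1 \ox 1.
Proof. exact: textE word_coact_mult [::]. Qed.

Lemma sw_talg_coact_cons (U : lmodType k) (g : T -> A -> U) v x : bilin g ->
  tlift (coact (tgen v * x)) g =
  \sw_(v0, v1 <- xcoact X v) \sw_(x0, x1 <- coact x) g (tgen v0 * x0) (v1 * x1).
Proof.
move=> bg; rewrite [coact _](text_rec coact_step_bilin) // /coact_step sw_sw //.
apply: eq_sw => v0 v1; rewrite sw_sw //; apply: eq_sw => x0 x1; exact: swE.
Qed.

Lemma talg_coact_counit x : \sw_(x0, a <- coact x) ((counit H a : k) *: x0) = x.
Proof.
move: x; apply: (talg_eq_ind (I := unit) (g := fun _ x => x)
  (f := fun _ x => \sw_(x0, a <- coact x) ((counit H a : k) *: x0))) => //.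
- by move=> _; lin.
- by move=> _; rewrite talg_coact1 swE; [rewrite rmorph1 scale1r | lin].
move=> v x /(_ tt) IH _; rewrite sw_talg_coact_cons; last by lin.
under eq_sw => v0 v1.
  under eq_sw => x0 x1 do rewrite rmorphM -scalerA scalerAr.
  rewrite -sw_scale -sw_mulr IH; over.
by rewrite (sw_xcounit (xcoact_counit crossedV v)); last by lin.
Qed.

Lemma talg_coact_coassoc x :
  \sw_(x0, a <- coact x) (x0 \ox cop H a)
  = \sw_(x0, a <- coact x) \sw_(x00, x01 <- coact x0) (x00 \ox (x01 \ox a)).
Proof.
move: x; apply: (talg_eq_ind (I := unit)
  (f := fun _ x => \sw_(x0, a <- coact x) (x0 \ox cop H a))
  (g := fun _ x => \sw_(x0, a <- coact x) \sw_(x00, x01 <- coact x0)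
     (x00 \ox (x01 \ox a)))) => //.
- by move=> _; lin.
- by move=> _; lin.
- move=> _; rewrite talg_coact1 !swE; try by lin.
  by rewrite talg_coact1 cop1 swE //; lin.
move=> v x /(_ tt) IH _; rewrite !sw_talg_coact_cons; try by lin.
(* With the legs of x outermost, the induction hypothesis applies while the sums over the legs of v
   are part of the test map. *)
transitivity (\sw_(x0, b <- coact x) \sw_(b1, b2 <- cop H b)
   \sw_(v0, a <- xcoact X v) \sw_(a1, a2 <- cop H a)
     ((tgen v0 * x0) \ox ((a1 * b1) \ox (a2 * b2)))).
  rewrite sw_exch; apply: eq_sw => x0 b; rewrite sw_exch; apply: eq_sw => v0 a.
  rewrite -[cop H _]sw_tens sw_copM; last by lin.
  rewrite (sw_bilr _ _ _ (@tmul_bilinear _ _ _)) sw_exch.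
  apply: eq_sw => a1 a2; rewrite (sw_bilr _ _ _ (@tmul_bilinear _ _ _)).
  by [].
rewrite (sw_xcoassoc lcoact IH); try by lin.
rewrite [RHS]sw_exch; apply: eq_sw => x0 b.
transitivity (\sw_(x00, x01 <- coact x0) \sw_(v0, a <- xcoact X v)
    \sw_(v00, v01 <- xcoact X v0) ((tgen v00 * x00) \ox ((v01 * x01) \ox (a * b)))).
  by apply: eq_sw => x00 x01; rewrite (sw_xcoassoc lX (xcoact_coassoc crossedV v)) //; lin.
rewrite sw_exch; apply: eq_sw => v0 a; rewrite sw_talg_coact_cons; last by lin.
by rewrite sw_exch.
Qed.

Lemma talg_coact_par b x : coact (tpar b x) = tmap (tpar b) id (coact x).
Proof.
have lp := @tpar_lin k V.
have lt c : linear (tmap (@tpar k V c) (id : A -> A)) by apply: tmap_lin.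
move: b x; apply: talg_eq_ind => [b|b|b|v x IH b]; [by lin | by lin | |].
  rewrite talg_coact1 tmapE // !tpar1; case: b; last by rewrite talg_coact1.
  by rewrite (lin0 lcoact) (lin0 (lin_tmull _ (@lin_id _ _))).
rewrite tpar_cons -[LHS]sw_tens sw_talg_coact_cons; last by lin.
rewrite /tmap sw_talg_coact_cons; last by lin.
apply: eq_sw => v0 v1; rewrite IH sw_tmap; last by lin.
by apply: eq_sw => x0 x1; rewrite tpar_cons.
Qed.

Lemma talg_act_par b x a : act (tpar b x) a = tpar b (act x a).
Proof.
have lp := @tpar_lin k V; suff E (p : bool * A) y :
  act (tpar p.1 y) p.2 = tpar p.1 (act y p.2) by exact: (E (b, a)).
move: p y; apply: talg_eq_ind => [p|p|[{}b {}a]|v {}x IH [{}b {}a]] /=; [by lin | by lin | |].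
  rewrite tpar1 talg_act1 (linZ (lp _)) tpar1; case: b; rewrite ?talg_act1 ?scaler0 //.
  by rewrite (lin0 (lin_bill a bact (@lin_id _ _))).
rewrite tpar_cons !talg_act_cons (sw_lin _ _ (lp _)).
by apply: eq_sw => a1 a2; rewrite (IH (~~ b, a2)) tpar_cons.
Qed.

End TensorXmod.

(** * Super-algebras *)

(* Algebra structures are bundled as laws rather than as [algType] instances, since
   several of them live on plain tensor products. *)
Record alg_law (k : fieldType) (B : lmodType k) := AlgLaw {
  amul : B -> B -> B;
  aone : B;
  amul_bilin : bilin amul;
  amulA : forall x y z, amul x (amul y z) = amul (amul x y) z;
  amul1l : forall x, amul aone x = x;
  amul1r : forall x, amul x aone = x
}.

Definition sgn (k : fieldType) (B : lmodType k) (par : bool -> B -> B) (x : B) : B :=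
  par false x - par true x.

(** A Z/2-grading given by its projections. In [par_mul] only y is made homogeneous; since the parts
    of y add up to y, this is full compatibility with the product. *)
Record super_law (k : fieldType) (B : lmodType k) (m : alg_law B)
    (par : bool -> B -> B) : Prop := SuperLaw {
  par_lin : forall b, linear (par b);
  par_sum : forall x, par false x + par true x = x;
  par_par : forall b c x, par b (par c x) = if b == c then par b x else 0;
  par_mul : forall b c x y,
    par b (amul m x (par c y)) = amul m (par (b (+) c) x) (par c y);
  par_one : forall b, par b (aone m) = if b then 0 else aone m
}.

Section Super.
Variables (k : fieldType) (B : lmodType k) (m : alg_law B) (par : bool -> B -> B).
Hypothesis sm : super_law m par.
Local Notation "x ** y" := (amul m x y) (at level 40, left associativity).
Local Notation sg := (sgn par).

Let bm := amul_bilin m.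
Let lp := par_lin sm.

Lemma amul0l x : 0 ** x = 0.
Proof. exact: (lin0 (lin_bill x bm (@lin_id _ _))). Qed.
Lemma amul0r x : x ** 0 = 0.
Proof. exact: (lin0 (lin_bilr x bm (@lin_id _ _))). Qed.
Lemma amulDl x y z : (x + y) ** z = x ** z + y ** z.
Proof. exact: (linD (lin_bill z bm (@lin_id _ _))). Qed.
Lemma amulDr x y z : x ** (y + z) = x ** y + x ** z.
Proof. exact: (linD (lin_bilr x bm (@lin_id _ _))). Qed.
Lemma amulNl x y : (- x) ** y = - (x ** y).
Proof. exact: (linN (lin_bill y bm (@lin_id _ _))). Qed.
Lemma amulNr x y : x ** (- y) = - (x ** y).
Proof. exact: (linN (lin_bilr x bm (@lin_id _ _))). Qed.
Lemma amulZl c x y : (c *: x) ** y = c *: (x ** y).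
Proof. exact: (linZ (lin_bill y bm (@lin_id _ _))). Qed.
Lemma amulZr c x y : x ** (c *: y) = c *: (x ** y).
Proof. exact: (linZ (lin_bilr x bm (@lin_id _ _))). Qed.

Lemma sgn_lin : linear sg.
Proof. by rewrite /sgn; lin. Qed.

Lemma sgn_par c x : sg (par c x) = if c then - par c x else par c x.
Proof. by rewrite /sgn !(par_par sm); case: c; rewrite /= ?subr0 ?sub0r. Qed.

Lemma par_sgn c x : par c (sg x) = if c then - par c x else par c x.
Proof.
rewrite /sgn (linB (lp c)) !(par_par sm).
by case: c; rewrite /= ?subr0 ?sub0r.
Qed.

Lemma sgnK x : sg (sg x) = x.
Proof. by rewrite {1}/sgn !par_sgn opprK (par_sum sm). Qed.

Lemma sgn_one : sg (aone m) = aone m.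
Proof. by rewrite /sgn !(par_one sm) subr0. Qed.

Lemma sgn_mul x y : sg (x ** y) = sg x ** sg y.
Proof.
rewrite -[in LHS](par_sum sm y) amulDr (linD sgn_lin) {1 2}/sgn !(par_mul sm) /=.
by rewrite /sgn !(amulDr, amulDl, amulNr, amulNl) opprK [- _ + _ in RHS]addrC.
Qed.

Lemma par_eq b x : par b x = x -> par (~~ b) x = 0.
Proof. by move=> <-; rewrite (par_par sm); case: b. Qed.

Lemma even_sgn x : par false x = x -> sgn par x = x.
Proof. by move=> e; rewrite /sgn (par_eq e) subr0 e. Qed.

Lemma odd_sgn x : par true x = x -> sgn par x = - x.
Proof. by move=> e; rewrite /sgn (par_eq e) sub0r e. Qed.

Lemma par_mul_even b x y : par false x = x -> par b (x ** y) = x ** par b y.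
Proof.
move=> e; have o := par_eq e.
rewrite -{1}(par_sum sm y) amulDr (linD (par_lin sm b)) !(par_mul sm).
by case: b; rewrite /= e o amul0l ?addr0 ?add0r.
Qed.

Lemma par_mul_odd b x y : par true x = x -> par b (x ** y) = x ** par (~~ b) y.
Proof.
move=> e; have o := par_eq e.
rewrite -{1}(par_sum sm y) amulDr (linD (par_lin sm b)) !(par_mul sm).
by case: b; rewrite /= e o amul0l ?addr0 ?add0r.
Qed.

(** For odd x the four parity terms collapse because the sign depends on y alone; graded centrality
    of x becomes the single identity x y = sgn(y) x. *)
Lemma scomm_odd x y : par true x = x -> scomm (amul m) par x y = x ** y - sgn par y ** x.
Proof.
move=> e; have o := par_eq e.
rewrite /scomm !big_bool /= e o !amul0l !amul0r scaler0 !subrr !addr0.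
rewrite expr0 expr1 scale1r scaleN1r opprK.
have -> : x ** y = x ** par false y + x ** par true y by rewrite -amulDr (par_sum sm).
by rewrite /sgn amulDl amulNl opprB addrACA [x ** par true y + _]addrC.
Qed.

End Super.

(** * The smash product as a super-algebra *)

Section Smash.
Variables (k : fieldType) (A : algType k) (H : hopf_algebra A) (L : bshopf_data A).

Record module_algebra : Prop := ModuleAlgebra {
  ma_bilin : bilin (xact (bs_xmod L));
  ma_id : forall x, xact (bs_xmod L) x 1 = x;
  ma_comp : forall x a b,
    xact (bs_xmod L) x (a * b) = xact (bs_xmod L) (xact (bs_xmod L) x a) b;
  ma_mul : forall x y a, xact (bs_xmod L) (x * y) a =
    \sw_(a1, a2 <- cop H a) (xact (bs_xmod L) x a1 * xact (bs_xmod L) y a2);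
  ma_one : forall a, xact (bs_xmod L) 1 a = (counit H a : k)%:A
}.

Hypothesis mL : module_algebra.
Local Notation act := (xact (bs_xmod L)).
Let bact : bilin act := ma_bilin mL.

Lemma smash_mulE a x b y : smash_mul H (L := L) (a \ox x) (b \ox y) =
  \sw_(b1, b2 <- cop H b) ((a * b1) \ox (act x b2 * y)).
Proof.
have h1 : bilin (fun (b : A) (y : L) =>
  \sw_(b1, b2 <- cop H b) ((a * b1) \ox (act x b2 * y))) by lin.
by rewrite /smash_mul swE ?swE //; lin.
Qed.

Lemma smash_mul_bilin : bilin (smash_mul H (L := L)).
Proof.
have hb a x : bilin (fun (b : A) (y : L) =>
  \sw_(b1, b2 <- cop H b) ((a * b1) \ox (act x b2 * y))) by lin.
by rewrite /smash_mul; lin.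
Qed.

Let bmul := smash_mul_bilin.
Local Notation "s ** t" := (smash_mul H (L := L) s t) (at level 40, left associativity).

Lemma smash_mulA s t u : s ** (t ** u) = (s ** t) ** u.
Proof.
move: u; apply: tens_ext => [||c z]; [by lin | by lin |].
move: t; apply: tens_ext => [||b y]; [by lin | by lin |].
move: s; apply: tens_ext => [||a x]; [by lin | by lin |].
rewrite !smash_mulE (sw_bilr _ _ _ bmul) (sw_bill _ _ _ bmul).
transitivity (\sw_(b1, b2 <- cop H b) \sw_(c1, c2 <- cop H c) \sw_(c11, c12 <- cop H c1)
  ((a * (b1 * c11)) \ox (act x (b2 * c12) * (act y c2 * z)))).
  rewrite sw_exch; apply: eq_sw => c1 c2.
  by rewrite smash_mulE sw_copM //; lin.
apply: eq_sw => b1 b2; rewrite smash_mulE -(sw_coassoc H); try by lin.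
apply: eq_sw => c1 c2; rewrite (ma_mul mL) sw_mull (sw_bilr _ _ _ (@tmul_bilinear _ _ _)).
by apply: eq_sw => c21 c22; rewrite (ma_comp mL) !mulrA.
Qed.

Lemma smash_mul1l s : (1 \ox 1) ** s = s.
Proof.
move: s; apply: tens_ext => [||a x]; [by lin | by lin |].
rewrite smash_mulE; under eq_sw do rewrite (ma_one mL) mul1r mulr_algl linearZr.
by rewrite (sw_counitr H); last by lin.
Qed.

Lemma smash_mul1r s : s ** (1 \ox 1) = s.
Proof.
move: s; apply: tens_ext => [||a x]; [by lin | by lin |].
by rewrite smash_mulE sw_cop1 ?mulr1 ?(ma_id mL) //; lin.
Qed.

Definition smash_law : alg_law (tens A L) :=
  AlgLaw smash_mul_bilin smash_mulA smash_mul1l smash_mul1r.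

Lemma smash_mul_algl a b x : (a \ox 1) ** (b \ox x) = (a * b) \ox x.
Proof.
rewrite smash_mulE; under eq_sw do rewrite (ma_one mL) mulr_algl linearZr.
by rewrite (sw_counitr H (f := fun b1 => (a * b1) \ox x)); last by lin.
Qed.

Lemma smash_mul_coef a x y : (a \ox x) ** (1 \ox y) = a \ox (x * y).
Proof. by rewrite smash_mulE sw_cop1 ?mulr1 ?(ma_id mL) //; lin. Qed.

Section Parity.
Definition algebra_law (R : algType k) : alg_law R.
Proof.
refine (@AlgLaw k R *%R 1 _ (@mulrA R) (@mul1r R) (@mulr1 R)).
by lin.
Defined.

Hypothesis pL : super_law (algebra_law L) (@bs_par _ _ L).
Hypothesis act_par : forall b (x : L) a, act (bs_par b x) a = bs_par b (act x a).

Let lpar : forall b, linear (@bs_par _ _ L b) := par_lin pL.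

Lemma smash_par_super : super_law smash_law (smash_par (L := L)).
Proof.
have lp b : linear (smash_par (L := L) b) by apply: tmap_lin.
have pE b a x : smash_par (L := L) b (a \ox x) = a \ox bs_par b x by exact: tmapE.
split=> //=.
- apply: tens_ext => [||a x]; [by lin | by lin |].
  rewrite !pE -linearDr.
  by rewrite (par_sum pL).
- move=> b c; apply: tens_ext => [||a x]; [by lin | by case: eqP => _; lin |].
  rewrite !pE (par_par pL); case: eqP => // _.
  exact: linear0r.
- move=> b c s t; move: t; apply: tens_ext => [||a' y]; [by lin | by lin |].
  move: s; apply: tens_ext => [||a x]; [by lin | by lin |].
  rewrite !pE !smash_mulE (sw_lin _ _ (lp b)); apply: eq_sw => a1 a2.
  rewrite pE; congr (_ \ox _); rewrite act_par; exact: (par_mul pL).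
- move=> b; rewrite pE; have := par_one pL b => /= ->; case: b => //.
  exact: linear0r.
Qed.

End Parity.

End Smash.

(** * The super tensor square of a super-algebra *)

Section SuperTensor.
Variables (k : fieldType) (B : lmodType k) (m : alg_law B) (par : bool -> B -> B).
Hypothesis sm : super_law m par.
Local Notation "x ** y" := (amul m x y) (at level 40, left associativity).

Let bm : bilin (amul m) := amul_bilin m.
Let lp : forall b, linear (par b) := par_lin sm.
Let lsgn : linear (sgn par) := sgn_lin sm.

Definition sgnb (c : bool) (x : B) : B := if c then sgn par x else x.

Lemma sgnb_lin c : linear (sgnb c).
Proof. by rewrite /sgnb; case: c; lin. Qed.
Let lsgnb := sgnb_lin.

Lemma sgnb_mul c x y : sgnb c (x ** y) = sgnb c x ** sgnb c y.
Proof. by case: c; rewrite /sgnb // (sgn_mul sm). Qed.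

Lemma sgnb_sgnb c d x : sgnb c (sgnb d x) = sgnb (c (+) d) x.
Proof. by case: c d => -[]; rewrite /sgnb //= (sgnK sm). Qed.

(** The Koszul sign (-1)^{|y||z|} is produced by splitting z only: its part of parity c lets
    [sgnb c] act on y. *)
Definition stens_mul (s t : tens B B) : tens B B :=
  \sw_(x, y <- s) \sw_(z, w <- t)
    \sum_(c : bool) ((x ** par c z) \ox (sgnb c y ** w)).

Let stens_inner x y : bilin (fun z w : B =>
  \sum_(c : bool) ((x ** par c z) \ox (sgnb c y ** w))).
Proof. by lin. Qed.

Lemma stens_mul_bilin : bilin stens_mul.
Proof. by have h := stens_inner; rewrite /stens_mul; lin. Qed.
Let bs := stens_mul_bilin.

Lemma stens_mulE x y z w : stens_mul (x \ox y) (z \ox w) =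
  \sum_(c : bool) ((x ** par c z) \ox (sgnb c y ** w)).
Proof. by have h := stens_inner; rewrite /stens_mul swE ?swE //; lin. Qed.

Lemma stens_mulA s t u : stens_mul s (stens_mul t u) = stens_mul (stens_mul s t) u.
Proof.
move: u; apply: tens_ext => [||u v]; [by lin | by lin |].
move: t; apply: tens_ext => [||z w]; [by lin | by lin |].
move: s; apply: tens_ext => [||x y]; [by lin | by lin |].
rewrite !stens_mulE (linS (lin_bilr _ bs (@lin_id _ _))) (linS (lin_bill _ bs (@lin_id _ _))).
under eq_bigr do rewrite stens_mulE.
under [RHS]eq_bigr do rewrite stens_mulE.
rewrite [RHS]exchange_big; apply: eq_bigr => d _.
(* On the left c is the parity of the product of z with the part d of u, on the right that of z
   alone; hence the shift by d. *)
rewrite (reindex_inj (@addIb d)); apply: eq_bigr => c _ /=.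
by rewrite (par_mul sm) addbK sgnb_mul sgnb_sgnb [d (+) c]addbC !amulA.
Qed.

Lemma stens_mul1l s : stens_mul (aone m \ox aone m) s = s.
Proof.
move: s; apply: tens_ext => [||x y]; [by lin | by lin |].
rewrite stens_mulE big_bool /sgnb /= (sgn_one sm) !amul1l.
by rewrite -linearDl addrC (par_sum sm).
Qed.

Lemma stens_mul1r s : stens_mul s (aone m \ox aone m) = s.
Proof.
move: s; apply: tens_ext => [||x y]; [by lin | by lin |].
rewrite stens_mulE big_bool !(par_one sm) /= amul0r !amul1r.
by rewrite linear0l add0r.
Qed.

Definition stens_law : alg_law (tens B B) :=
  AlgLaw stens_mul_bilin stens_mulA stens_mul1l stens_mul1r.

Local Notation "s *** t" := (stens_mul s t) (at level 40, left associativity).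

Lemma stens_mul_evenl x y z w : sgn par y = y ->
  (x \ox y) *** (z \ox w) = (x ** z) \ox (y ** w).
Proof.
move=> ey; rewrite (stens_mulE) big_bool /sgnb /= ey -linearDl -amulDr addrC.
by rewrite (par_sum sm).
Qed.

Lemma stens_mul_oddl x y z w : sgn par y = - y ->
  (x \ox y) *** (z \ox w) = (x ** sgn par z) \ox (y ** w).
Proof.
move=> ey; rewrite (stens_mulE) big_bool /sgnb /= ey amulNl linearNr addrC.
by rewrite /sgn amulDr amulNr linearBl.
Qed.

Lemma stens_mul_evenr x y z w : par false z = z ->
  (x \ox y) *** (z \ox w) = (x ** z) \ox (y ** w).
Proof.
move=> ez; rewrite (stens_mulE) big_bool /sgnb /= ez (par_eq sm ez) amul0r.
by rewrite linear0l add0r.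
Qed.

(** Since t and the unit are even, no sign arises and each summand commutes factor by factor. *)
Lemma stens_central t s : par false t = t -> (forall x, t ** x = x ** t) ->
  (t \ox aone m + aone m \ox t) *** s = s *** (t \ox aone m + aone m \ox t).
Proof.
move=> et ct.
move: s; apply: tens_ext => [||x y]; [by lin | by lin |].
rewrite (linD (lin_bill _ bs (@lin_id _ _))) (linD (lin_bilr _ bs (@lin_id _ _))).
have s1 := sgn_one sm; have st := even_sgn sm et; have e1 := par_one sm false.
by rewrite (stens_mul_evenl _ _ _ s1) (stens_mul_evenl _ _ _ st) (stens_mul_evenr _ _ _ et)
  (stens_mul_evenr _ _ _ e1) !amul1l !amul1r (ct x) (ct y).
Qed.

Section SkewCoderivation.
Variables (I : B -> B).
Hypotheses (lI : linear I) (I_par : forall c x, I (par c x) = par (~~ c) (I x)).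

Definition skew_coder (t : tens B B) : tens B B := tmap I id t + tmap (sgn par) I t.

Lemma skew_coder_lin : linear skew_coder.
Proof.
have ls := sgn_lin sm; rewrite /skew_coder.
have l1 : linear (tmap I (id : B -> B)) by apply: tmap_lin.
have l2 : linear (tmap (sgn par) I) by apply: tmap_lin.
by lin.
Qed.

Lemma skew_coderE x y : skew_coder (x \ox y) = I x \ox y + sgn par x \ox I y.
Proof. by have ls := sgn_lin sm; rewrite /skew_coder !tmapE. Qed.

Lemma I_sgn x : I (sgn par x) = - sgn par (I x).
Proof. by rewrite /sgn (linB lI) !I_par /= opprB. Qed.

Hypothesis derI : forall x y, I (x ** y) = I x ** y + sgn par x ** I y.

(** I \ox id + id \ox I, with Koszul signs, is a super-derivation of the super tensor square, and
    [tmap (sgn par) (sgn par)] is the sign automorphism there. So the two sides of the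
    super-coderivation identity obey the same product rule. *)
Lemma skew_coder_mul s t :
  skew_coder (s *** t) = skew_coder s *** t + tmap (sgn par) (sgn par) s *** skew_coder t.
Proof.
have ld := skew_coder_lin; have ls := sgn_lin sm.
have lss : linear (tmap (sgn par) (sgn par)) by apply: tmap_lin.
move: t; apply: tens_ext => [||z w]; [by lin | by lin |].
move: s; apply: tens_ext => [||x y]; [by lin | by lin |].
rewrite !skew_coderE tmapE // (linD (lin_bill _ bs (@lin_id _ _))).
rewrite (linD (lin_bilr _ bs (@lin_id _ _))).
rewrite !(stens_mulE) (linS ld) !big_bool /sgnb /= !skew_coderE.
rewrite !derI !I_par /= !I_sgn (sgnK sm).
rewrite !(sgn_mul sm) !(sgn_par sm) !(par_sgn sm) /=.
rewrite !(linearDl, linearDr, amulNl, amulNr, linearNl, linearNr) /=.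
rewrite opprK.
(* Eight terms on each side, one for each parity of z and each of the factors x, y, z, w hit by I;
   only their order differs. *)
by rewrite [LHS](AC ((2*2)*(2*2)) (((1*5)*(3*7))*((6*2)*(4*8)))).
Qed.

End SkewCoderivation.
End SuperTensor.

(** * Super-derivations as algebra maps *)

Section SkewExtension.
Variables (k : fieldType) (B : lmodType k) (m : alg_law B) (par : bool -> B -> B).
Hypothesis sm : super_law m par.
Local Notation "x ** y" := (amul m x y) (at level 40, left associativity).

Let bm : bilin (amul m) := amul_bilin m.
Let lsgn : linear (sgn par) := sgn_lin sm.

(* An algebra map x |-> (x, I x) into this algebra is the same as a
   super-derivation I. *)
Definition skew_mul (p q : B * B) : B * B :=
  (p.1 ** q.1, p.2 ** q.1 + sgn par p.1 ** q.2).

Lemma lin_pair (U : lmodType k) (f g : U -> B) :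
  linear f -> linear g -> linear (fun x => (f x, g x) : B * B).
Proof. by move=> lf lg a x y; rewrite lf lg. Qed.

Lemma lin_fst (U : lmodType k) (f : U -> B * B) : linear f -> linear (fun x => (f x).1).
Proof. by move=> lf a x y; rewrite lf. Qed.

Lemma lin_snd (U : lmodType k) (f : U -> B * B) : linear f -> linear (fun x => (f x).2).
Proof. by move=> lf a x y; rewrite lf. Qed.

Lemma skew_mul_bilin : bilin skew_mul.
Proof.
have l1 := lin_fst (@lin_id _ _); have l2 := lin_snd (@lin_id _ _).
by apply: bilP => p; apply: lin_pair; lin.
Qed.

Lemma skew_mulA p q r : skew_mul p (skew_mul q r) = skew_mul (skew_mul p q) r.
Proof.
rewrite /skew_mul /= (sgn_mul sm) !(amulDl, amulDr) !amulA.
by rewrite addrA.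
Qed.

Lemma skew_mul1l p : skew_mul (aone m, 0) p = p.
Proof. by rewrite /skew_mul /= (sgn_one sm) !amul1l amul0l add0r -surjective_pairing. Qed.

Lemma skew_mul1r p : skew_mul p (aone m, 0) = p.
Proof. by rewrite /skew_mul /= !amul1r amul0r addr0 -surjective_pairing. Qed.

Definition skew_law : alg_law (B * B)%type :=
  AlgLaw skew_mul_bilin skew_mulA skew_mul1l skew_mul1r.

Lemma skew_lawE x u y w :
  amul skew_law (x, u) (y, w) = (x ** y, u ** y + sgn par x ** w).
Proof. by []. Qed.

Lemma skew_law1 p q : (amul skew_law p q).1 = p.1 ** q.1.
Proof. by []. Qed.

Lemma skew_law2 p q : (amul skew_law p q).2 = p.2 ** q.1 + sgn par p.1 ** q.2.
Proof. by []. Qed.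

End SkewExtension.

(** * The quotient Lambda_theta *)

Section LambdaTheta.
Variables (k : fieldType) (A : algType k) (H : hopf_algebra A).
Variables (V : lmodType k) (X : xmod_data A V) (crossedV : crossed_module H X).
Variable theta : V.
Local Notation T := (talg V).
Local Notation act := (talg_act H X).
Local Notation Lam := (lam H X theta).
Local Notation pi := (@lam_pi k A H V X theta).
Local Notation ideal := (theta_ideal H X theta).
Local Notation th2 := (tgen theta ^+ 2).
Local Notation L := (Lambda_theta H X theta).

Let bact := talg_act_bilin crossedV.

Lemma lam_pi_lin : linear pi.
Proof. by move=> a x y; rewrite -lam_pi_add -lam_pi_scale. Qed.
Let lpi := lam_pi_lin.

Lemma lam_piM x y : pi (x * y) = pi x * pi y.
Proof. by rewrite -lam_pi_mul. Qed.

Lemma lam_pi1 : pi 1 = 1.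
Proof. by []. Qed.

Lemma lam_pi_eq0 x : pi x = 0 <-> ideal x.
Proof.
by rewrite -(lin0 lpi); split=> [/lam_eqP|h]; rewrite ?subr0 //; apply/lam_eqP; rewrite subr0.
Qed.

(** a minus its counit lies in A^+, where the ideal forces the action on theta^2 to vanish; so
    theta^2 is A-invariant in the quotient. *)
Lemma lam_pi_th2_act a : pi (act th2 a) = (counit H a : k) *: pi th2.
Proof.
apply/eqP; rewrite -subr_eq0 -(linZ lpi) -(linB lpi); apply/eqP/lam_pi_eq0.
have -> : act th2 a - (counit H a : k) *: th2 = act th2 (a - (counit H a : k)%:A).
  have l := lin_bilr th2 bact (@lin_id _ _).
  by rewrite (linB l) (linZ l) (talg_act_id crossedV).
by apply: theta_ideal_act; rewrite linearB linearZ /= rmorph1 [_ *: _]mulr1 subrr.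
Qed.

Lemma lam_pi_th2_comm x : pi th2 * pi x = pi x * pi th2.
Proof.
move: x; apply: talg_ind => [c x y hx hy||v x hx].
- by rewrite lpi mulrDr mulrDl -scalerAr -scalerAl hx hy.
- by rewrite lam_pi1 mulr1 mul1r.
rewrite lam_piM -mulrA -hx !mulrA; congr (_ * _).
apply/eqP; rewrite -subr_eq0 -!lam_piM -(linB lpi); apply/eqP/lam_pi_eq0.
exact: theta_ideal_comm.
Qed.

(** The computation takes place in the quotient. There theta^2 is invariant and central, so acting
    by a on a commutator with eta gives a commutator with eta <| a; for the other generators, b in
    A^+ implies b a in A^+. *)
Lemma theta_ideal_stable x a : ideal x -> ideal (act x a).
Proof.
move=> h; apply/lam_pi_eq0; elim: h a => [b hb|eta||y z _ hy _ hz|y z _ hz|y z _ hy] a.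
- apply/lam_pi_eq0; rewrite -(talg_act_comp crossedV); apply: theta_ideal_act.
  by rewrite rmorphM /= hb mul0r.
- have l := lin_bill a bact (@lin_id _ _).
  rewrite (linB l) !(talg_actM crossedV) (linB lpi) !(sw_lin _ _ lpi).
  under eq_sw do rewrite lam_piM lam_pi_th2_act -scalerAl lam_pi_th2_comm.
  rewrite (sw_counitl H (f := fun a => pi (act (tgen eta) a) * pi th2)); last by lin.
  under [X in _ - X]eq_sw do rewrite lam_piM lam_pi_th2_act -scalerAr.
  rewrite (sw_counitr H (f := fun a => pi (act (tgen eta) a) * pi th2)) ?subrr //; lin.
- by rewrite (lin0 (lin_bill a bact (@lin_id _ _))) (lin0 lpi).
- by rewrite (linD (lin_bill a bact (@lin_id _ _))) (linD lpi) hy hz addr0.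
- rewrite (talg_actM crossedV) (sw_lin _ _ lpi) sw0 // => a1 a2.
  by rewrite lam_piM hz mulr0.
- rewrite (talg_actM crossedV) (sw_lin _ _ lpi) sw0 // => a1 a2.
  by rewrite lam_piM hy mul0r.
Qed.

Lemma tpar_gen_mul b v w : tpar b (tgen v * tgen w) = if b then 0 else tgen v * tgen w :> T.
Proof. by rewrite tpar_cons tpar_gen; case: b; rewrite /= ?mulr0. Qed.

(** The generators of the ideal are homogeneous: theta^2 <| a is even and the commutator with eta is
    odd. *)
Lemma theta_ideal_tpar b x : ideal x -> ideal (tpar b x).
Proof.
have lp := @tpar_lin k V.
move=> h; elim: h b => [a ha|eta||y z _ hy _ hz|y z _ hz|y z _ hy] b.
- rewrite -(talg_act_par crossedV) expr2 tpar_gen_mul; case: b; last exact: theta_ideal_act.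
  by rewrite (lin0 (lin_bill a bact (@lin_id _ _))); exact: theta_ideal0.
- rewrite expr2 (linB (lp b)) -mulrA !tpar_cons !tpar_gen !negbK.
  case: b; rewrite ?mulr0 ?subrr; last exact: theta_ideal0.
  by rewrite mulrA; exact: theta_ideal_comm.
- by rewrite (lin0 (lp b)); exact: theta_ideal0.
- by rewrite (linD (lp b)); exact: theta_idealD.
(* The right factor is split into its parity parts, as [tpar_mul] requires; here it is the factor in
   the ideal, in the next case it is the other one. *)
- rewrite -[z](tpar_sum z) mulrDr (linD (lp b)) !tpar_mul.
  by apply: theta_idealD; apply: theta_idealMl.
- rewrite -[z](tpar_sum z) mulrDr (linD (lp b)) !tpar_mul.
  by apply: theta_idealD; apply: theta_idealMr.
Qed.

Lemma lam_act_pi x a : lam_act (pi x) a = pi (act x a).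
Proof.
have l := lin_bill a bact (@lin_id _ _).
by apply/lam_eqP; rewrite -(linB l); apply: theta_ideal_stable; exact: lam_repr_pi.
Qed.

Lemma lam_par_pi b x : lam_par b (pi x) = pi (tpar b x).
Proof.
by apply/lam_eqP; rewrite -(linB (@tpar_lin k V b)); apply: theta_ideal_tpar; exact: lam_repr_pi.
Qed.

Lemma Lambda_module_algebra : module_algebra H L.
Proof.
split=> /=.
- apply: bilP => [a|x] c.
    elim/lamW=> x; elim/lamW=> y; rewrite -lpi !lam_act_pi.
    by rewrite -lpi (lin_bill a bact (@lin_id _ _)).
  by move=> a b; elim/lamW: x => x; rewrite !lam_act_pi (lin_bilr x bact (@lin_id _ _)) lpi.
- by elim/lamW=> x; rewrite lam_act_pi (talg_act_id crossedV).
- by elim/lamW=> x a b; rewrite !lam_act_pi (talg_act_comp crossedV).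
- elim/lamW=> x; elim/lamW=> y a; rewrite -lam_piM lam_act_pi (talg_actM crossedV).
  rewrite (sw_lin _ _ lpi); apply: eq_sw => a1 a2.
  by rewrite lam_piM !lam_act_pi.
- by move=> a; rewrite -lam_pi1 lam_act_pi (talg_act1 crossedV) (linZ lpi).
Qed.

Lemma Lambda_super : super_law (algebra_law L) (@bs_par _ _ L).
Proof.
have lp := @tpar_lin k V; split=> /=.
- move=> b c; elim/lamW=> x; elim/lamW=> y.
  by rewrite -lpi !lam_par_pi lp lpi.
- by elim/lamW=> x; rewrite !lam_par_pi -(linD lpi) tpar_sum.
- move=> b c; elim/lamW=> x; rewrite !lam_par_pi tpar_par.
  by case: eqP => // _; rewrite (lin0 lpi).
- move=> b c; elim/lamW=> x; elim/lamW=> y. rewrite (lam_par_pi c) -lam_piM 2!lam_par_pi -lam_piM.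
  by rewrite tpar_mul.
- by move=> b; rewrite -lam_pi1 lam_par_pi tpar1; case: b => //; rewrite (lin0 lpi).
Qed.

Lemma Lambda_act_par b (x : L) a :
  xact (bs_xmod L) (bs_par b x) a = bs_par b (xact (bs_xmod L) x a).
Proof.
by elim/lamW: x => x /=; rewrite !(lam_par_pi, lam_act_pi) (talg_act_par crossedV).
Qed.

End LambdaTheta.

(** * Algebra maps out of A # Lambda_theta *)

Section Universal.
Variables (k : fieldType) (A : algType k) (H : hopf_algebra A).
Variables (V : lmodType k) (X : xmod_data A V) (crossedV : crossed_module H X).
Variables (B : lmodType k) (m : alg_law B) (j : A -> B) (f : V -> B).
Local Notation T := (talg V).
Local Notation act := (talg_act H X).
Local Notation "x ** y" := (amul m x y) (at level 40, left associativity).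

Record covariant_pair : Prop := CovariantPair {
  cp_linl : linear j;
  cp_linr : linear f;
  cp_one : j 1 = aone m;
  cp_mul : forall a b, j (a * b) = j a ** j b;
  cp_cov : forall v a, \sw_(a1, a2 <- cop H a) (j a1 ** f (xact X v a2)) = f v ** j a
}.

Hypothesis jf : covariant_pair.
Let bm : bilin (amul m) := amul_bilin m.
Let lj : linear j := cp_linl jf.
Let lf : linear f := cp_linr jf.
Let bact := talg_act_bilin crossedV.
Let bX := xact_bilinear crossedV.

Definition alg_ext : T -> B := text (foldr (fun v y => f v ** y) (aone m)).

Let step_bilin : bilin (fun v y => f v ** y).
Proof. by lin. Qed.

Let fold_mult : multilinear (foldr (fun v y => f v ** y) (aone m)).
Proof. exact: (multilinear_rec step_bilin). Qed.

Lemma alg_ext_lin : linear alg_ext.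
Proof. exact: text_linear fold_mult. Qed.
Let lext := alg_ext_lin.

Lemma alg_ext1 : alg_ext 1 = aone m.
Proof. exact: textE fold_mult [::]. Qed.

Lemma alg_ext_cons v x : alg_ext (tgen v * x) = f v ** alg_ext x.
Proof. exact: (text_rec step_bilin). Qed.

Lemma alg_ext_gen v : alg_ext (tgen v) = f v.
Proof. by rewrite -[tgen v]mulr1 alg_ext_cons alg_ext1 amul1r. Qed.

Lemma alg_extM x y : alg_ext (x * y) = alg_ext x ** alg_ext y.
Proof.
move: x; apply: talg_ind => [c x x' hx hx'||v x IH].
- by rewrite mulrDl -scalerAl !lext hx hx' amulDl amulZl.
- by rewrite mul1r alg_ext1 amul1l.
by rewrite -mulrA !alg_ext_cons IH amulA.
Qed.

Lemma alg_ext_cov x a :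
  \sw_(a1, a2 <- cop H a) (j a1 ** alg_ext (act x a2)) = alg_ext x ** j a.
Proof.
move: a x; apply: talg_eq_ind => [a|a|a|v x IH a]; [by lin | by lin | |].
  under eq_sw do rewrite (talg_act1 crossedV) (linZ lext) alg_ext1 amulZr amul1r.
  by rewrite (sw_counitr H) // alg_ext1 amul1l.
under eq_sw => a1 a2.
  rewrite (talg_act_cons crossedV) (sw_lin _ _ lext) (sw_bilr _ _ _ bm).
  under eq_sw do rewrite alg_ext_cons amulA.
  over.
rewrite (sw_coassoc H); try by lin.
under eq_sw do rewrite -(sw_bill _ _ _ bm) (cp_cov jf) -amulA.
by rewrite -(sw_bilr _ _ _ bm) IH alg_ext_cons amulA.
Qed.

Variable theta : V.
Local Notation c := (f theta ** f theta).
Hypothesis comm_f : forall v, c ** f v = f v ** c.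
Hypothesis comm_j : forall a, c ** j a = j a ** c.

(** Inserting S(a_1) a_2 in front turns [alg_ext_cov] into F(x <| a) = j(S a_1) F(x) j(a_2), with F
    = [alg_ext]. For F(x) = c, which commutes with j, the outer factors meet and give the counit. *)
Lemma alg_ext_th2_act a : alg_ext (act (tgen theta ^+ 2) a) = (counit H a : k) *: c.
Proof.
set x := _ ^+ 2.
have cx : alg_ext x = c by rewrite /x expr2 alg_extM alg_ext_gen.
rewrite -[LHS](sw_counitl H (f := fun a => alg_ext (act x a))); last by lin.
transitivity (\sw_(a1, a2 <- cop H a) \sw_(b1, b2 <- cop H a1)
  (j (antipode H b1) ** (j b2 ** alg_ext (act x a2)))).
  apply: eq_sw => a1 a2; under eq_sw do rewrite amulA -(cp_mul jf).
  rewrite (sw_antipodel H (f := fun a => j a ** alg_ext (act x a2))); last by lin.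
  by rewrite (cp_one jf) amul1l.
rewrite -(sw_coassoc H); try by lin.
under eq_sw do rewrite -(sw_bilr _ _ _ bm) alg_ext_cov cx comm_j amulA -(cp_mul jf).
rewrite (sw_antipodel H (f := fun a => j a ** c)); last by lin.
by rewrite (cp_one jf) amul1l.
Qed.

Lemma alg_ext_kill x : theta_ideal H X theta x -> alg_ext x = 0.
Proof.
elim=> [a ha|eta||y z _ hy _ hz|y z _ hz|y z _ hy].
- by rewrite alg_ext_th2_act ha scale0r.
- by rewrite (linB lext) expr2 !alg_extM !alg_ext_gen comm_f subrr.
- exact: (lin0 lext).
- by rewrite (linD lext) hy hz addr0.
- by rewrite alg_extM hz amul0r.
- by rewrite alg_extM hy amul0l.
Qed.

Local Notation L := (Lambda_theta H X theta).

Definition lam_ext (x : lam H X theta) : B := alg_ext (lam_repr x).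

Lemma lam_ext_pi x : lam_ext (lam_pi H X theta x) = alg_ext x.
Proof.
apply/eqP; rewrite -subr_eq0 -(linB lext); apply/eqP.
by apply: alg_ext_kill; exact: lam_repr_pi.
Qed.

Lemma lam_ext_lin : linear lam_ext.
Proof.
move=> a; elim/lamW=> x; elim/lamW=> y.
by rewrite -lam_pi_lin !lam_ext_pi lext.
Qed.

Definition smash_ext (s : tens A L) : B := \sw_(a, x <- s) (j a ** lam_ext x).

Lemma smash_ext_lin : linear smash_ext.
Proof. by have ll := lam_ext_lin; rewrite /smash_ext; lin. Qed.

Lemma smash_extE a x : smash_ext (a \ox lam_pi H X theta x) = j a ** alg_ext x.
Proof.
by have ll := lam_ext_lin; rewrite /smash_ext swE ?lam_ext_pi //; lin.
Qed.

Lemma smash_extM s t : smash_ext (smash_mul H (L := L) s t) = smash_ext s ** smash_ext t.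
Proof.
have bmul := smash_mul_bilin (Lambda_module_algebra crossedV theta).
have ls := smash_ext_lin.
move: t; apply: tens_ext => [||b y]; [by lin | by lin |].
move: s; apply: tens_ext => [||a x]; [by lin | by lin |].
elim/lamW: x => x; elim/lamW: y => y.
rewrite smash_mulE; last exact: Lambda_module_algebra.
rewrite !smash_extE (sw_lin _ _ ls).
under eq_sw => b1 b2.
  rewrite [xact _ _ _]lam_act_pi // -lam_piM smash_extE (cp_mul jf) alg_extM amulA -(amulA _ (j a)).
  over.
rewrite -(sw_bill _ _ _ bm) -(sw_bilr _ _ _ bm) alg_ext_cov.
by rewrite !amulA.
Qed.

End Universal.

(** * The algebra Omega_theta: generators, theta^2 and degrees *)

Section Omega.
Variables (k : fieldType) (A : algType k) (H : hopf_algebra A).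
Variables (V : lmodType k) (X : xmod_data A V) (crossedV : crossed_module H X).
Variable theta : V.
Local Notation T := (talg V).
Local Notation Lam := (lam H X theta).
Local Notation pi := (@lam_pi k A H V X theta).
Local Notation L := (Lambda_theta H X theta).
Local Notation Om := (tens A Lam).

Let mL := Lambda_module_algebra crossedV theta.

Definition Omega_law : alg_law Om := smash_law mL.
Local Notation par := (smash_par (L := L)).
Local Notation "s ** t" := (amul Omega_law s t) (at level 40, left associativity).

Lemma Omega_super : super_law Omega_law par.
Proof.
exact: smash_par_super (Lambda_super crossedV theta) (@Lambda_act_par _ _ _ _ _ crossedV theta).
Qed.
Let sO := Omega_super.

Definition emb_alg (a : A) : Om := a \ox 1.
Definition emb_gen (v : V) : Om := 1 \ox pi (tgen v).

Lemma emb_alg_gen a v : emb_alg a ** emb_gen v = a \ox pi (tgen v).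
Proof. by rewrite /= smash_mul_algl // mulr1. Qed.

Lemma Omega_covariant : covariant_pair H X Omega_law emb_alg emb_gen.
Proof.
have lpi := @lam_pi_lin k A H V X theta.
have lg := @tgen_lin k V.
split.
- by rewrite /emb_alg; lin.
- by rewrite /emb_gen; lin.
- by [].
- by move=> a b; rewrite /emb_alg /= smash_mul_algl.
move=> v a; rewrite [RHS]smash_mulE //; apply: eq_sw => a1 a2.
rewrite emb_alg_gen mul1r /= lam_act_pi // mulr1.
by rewrite (talg_act_gen crossedV).
Qed.

Lemma emb_alg_even a : par false (emb_alg a) = emb_alg a.
Proof.
have lp := par_lin (Lambda_super crossedV theta) false.
rewrite [LHS]tmapE //; congr (_ \ox _); exact: (par_one (Lambda_super crossedV theta)).
Qed.

Lemma emb_gen_odd v : par true (emb_gen v) = emb_gen v.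
Proof.
have lp := par_lin (Lambda_super crossedV theta) true.
by rewrite [LHS]tmapE //= lam_par_pi // tpar_gen.
Qed.

Lemma emb_genM v w : emb_gen v ** emb_gen w = 1 \ox pi (tgen v * tgen w).
Proof. by rewrite lam_piM; exact: (smash_mul_coef mL 1 (pi (tgen v)) (pi (tgen w))). Qed.

(** The invariance of theta^2 makes it commute with A, the commutator relations make it commute with
    [Lambda_theta]. *)
Lemma emb_th2_central s :
  (emb_gen theta ** emb_gen theta) ** s = s ** (emb_gen theta ** emb_gen theta).
Proof.
have bs := amul_bilin Omega_law; have bact := ma_bilin mL.
move: s; apply: tens_ext => [||a]; [by lin | by lin |].
elim/lamW=> x; rewrite emb_genM [RHS]smash_mulE // [LHS]smash_mulE //.
rewrite sw_cop1; last by lin.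
under eq_sw => a1 a2.
  rewrite /= lam_act_pi // -expr2 lam_pi_th2_act // mul1r -scalerAl linearZr /=.
  over.
rewrite (sw_counitr H (f := fun a1 => a1 \ox (pi (tgen theta ^+ 2) * pi x))); last by lin.
rewrite mulr1 (ma_id mL) -expr2; congr (_ \ox _); exact: lam_pi_th2_comm.
Qed.

Lemma emb_th2_even v : par false (emb_gen v ** emb_gen v) = emb_gen v ** emb_gen v.
Proof.
by have := par_mul sO false true (emb_gen v) (emb_gen v); rewrite !emb_gen_odd.
Qed.

Local Notation deg := (smash_deg (L := L)).

Lemma smash_deg0 n : deg n 0.
Proof. by exists [::]; split=> [p|]; rewrite ?in_nil ?big_nil. Qed.

Lemma smash_degD n s t : deg n s -> deg n t -> deg n (s + t).
Proof.
move=> [r [hr ->]] [q [hq ->]]; exists (r ++ q); rewrite big_cat; split=> // p.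
by rewrite mem_cat => /orP [/hr|/hq].
Qed.

Lemma smash_deg_sum n (I : Type) (r : seq I) (F : I -> Om) :
  (forall i, deg n (F i)) -> deg n (\sum_(i <- r) F i).
Proof. by move=> h; apply: big_ind => //; [exact: smash_deg0 | exact: smash_degD]. Qed.

Lemma smash_deg_pure n a (x : Lam) : lam_deg n x -> deg n (a \ox x).
Proof.
by move=> h; exists [:: (a, x)]; rewrite big_seq1; split=> // p; rewrite inE => /eqP ->.
Qed.

Lemma smash_degZ n c s : deg n s -> deg n (c *: s).
Proof.
move=> [r [hr ->]]; rewrite scaler_sumr big_seq.
apply: big_ind => [||p /hr hp]; [exact: smash_deg0 | by move=> *; apply: smash_degD |].
by rewrite -linearZl; apply: smash_deg_pure.
Qed.

Lemma smash_deg_alg n a s : deg n s -> deg n (emb_alg a ** s).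
Proof.
have bO := amul_bilin Omega_law.
move=> [r [hr ->]]; rewrite (linS (lin_bilr (emb_alg a) bO (@lin_id _ _))) big_seq.
apply: big_ind => [||p /hr hp]; [exact: smash_deg0 | by move=> *; apply: smash_degD |].
by rewrite [amul _ _ _]smash_mul_algl //; apply: smash_deg_pure.
Qed.

Lemma lam_deg_gen n v (x : Lam) : lam_deg n x -> lam_deg n.+1 (pi (tgen v) * x).
Proof.
move=> [t [[q [hq ->]] ->]]; rewrite -lam_piM; eexists; split; last by [].
exists [seq (p.1, v :: p.2) | p <- q]; rewrite all_map; split; first exact: hq.
rewrite mulr_sumr big_map; apply: eq_bigr => p _.
by rewrite tword_cons scalerAr.
Qed.

Lemma smash_deg_gen n v s : deg n s -> deg n.+1 (emb_gen v ** s).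
Proof.
have bO := amul_bilin Omega_law.
move=> [r [hr ->]]; rewrite (linS (lin_bilr (emb_gen v) bO (@lin_id _ _))) big_seq.
apply: big_ind => [||[b x] /hr hp]; [exact: smash_deg0 | by move=> *; apply: smash_degD |].
rewrite [amul _ _ _]smash_mulE //; apply: smash_deg_sum => -[b1 b2] /=.
apply: smash_deg_pure; rewrite lam_act_pi // (talg_act_gen crossedV).
exact: lam_deg_gen.
Qed.

(** Words times elements of A span, so left multiplications by generators reach everything from 1.
    Properties of a super-derivation are then proved from its values on A and V. *)
Lemma Omega_ind (P : Om -> Prop) :
  (forall c s t, P s -> P t -> P (c *: s + t)) -> P (aone Omega_law) ->
  (forall a s, P s -> P (emb_alg a ** s)) -> (forall v s, P s -> P (emb_gen v ** s)) ->
  forall s, P s.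
Proof.
move=> hD h1 ha hv; apply: tens_ind => // a x.
rewrite -[a]mulr1 -(smash_mul_algl mL); apply: ha.
elim/lamW: x; apply: talg_ind => [c x y hx hy|//|v x hx].
  by rewrite lam_pi_lin linearDr linearZr; apply: hD.
by rewrite lam_piM -(smash_mul_coef mL); apply: hv.
Qed.

End Omega.

(** * The coproduct of Omega_theta *)

Section Coproduct.
Variables (k : fieldType) (A : algType k) (H : hopf_algebra A).
Variables (V : lmodType k) (X : xmod_data A V) (crossedV : crossed_module H X).
Variable theta : V.
Hypothesis theta_inv : xcoact X theta = theta \ox 1.
Local Notation T := (talg V).
Local Notation Lam := (lam H X theta).
Local Notation pi := (@lam_pi k A H V X theta).
Local Notation L := (Lambda_theta H X theta).
Local Notation Om := (tens A Lam).
Local Notation OmL := (Omega_law crossedV theta).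
Local Notation par := (smash_par (L := L)).
Local Notation "s ** t" := (amul OmL s t) (at level 40, left associativity).
Local Notation emb_alg := (@emb_alg k A H V X theta).
Local Notation emb_gen := (@emb_gen k A H V X theta).
Local Notation act := (talg_act H X).
Local Notation coact := (talg_coact X).

Let sO : super_law OmL par := Omega_super crossedV theta.
Let gcov : covariant_pair H X OmL emb_alg emb_gen := Omega_covariant crossedV theta.
Let lemb_alg : linear emb_alg := cp_linl gcov.
Let lemb_gen : linear emb_gen := cp_linr gcov.
Let bO : bilin (amul OmL) := amul_bilin OmL.
Let bX := xact_bilinear crossedV.
Let lX := xcoact_linear crossedV.

Definition OmOm_law := stens_law sO.
Local Notation "s *** t" := (amul OmOm_law s t) (at level 40, left associativity).
Let bOO : bilin (amul OmOm_law) := amul_bilin OmOm_law.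

Definition cop_alg (a : A) : tens Om Om := \sw_(a1, a2 <- cop H a) (emb_alg a1 \ox emb_alg a2).
(** What the smash coproduct formula gives for the primitive v: its part v \ox 1 picks up the
    coaction, 1 \ox v does not. *)
Definition cop_gen (v : V) : tens Om Om :=
  \sw_(v0, v1 <- xcoact X v) (emb_gen v0 \ox emb_alg v1) + aone OmL \ox emb_gen v.

Lemma sgn_emb_alg a : sgn par (emb_alg a) = emb_alg a.
Proof. by apply: (even_sgn sO); exact: emb_alg_even. Qed.

Lemma sgn_emb_gen v : sgn par (emb_gen v) = - emb_gen v.
Proof. by apply: (odd_sgn sO); exact: emb_gen_odd. Qed.

(** For the summand 1 \ox v coassociativity and the cross relation in Omega suffice. For v_0 \ox v_1
    the crossed module compatibility enters, and its factor S(a_1) has to be cancelled. *)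
Lemma cop_covariant : covariant_pair H X OmOm_law cop_alg cop_gen.
Proof.
split.
- by rewrite /cop_alg; lin.
- by rewrite /cop_gen; lin.
- by rewrite /cop_alg sw_cop1 //; lin.
- move=> a b; rewrite /cop_alg sw_copM; last by lin.
  rewrite (sw_bill _ _ _ bOO); apply: eq_sw => a1 a2.
  rewrite (sw_bilr _ _ _ bOO); apply: eq_sw => b1 b2.
  by rewrite [RHS](stens_mul_evenl sO) ?sgn_emb_alg // -!(cp_mul gcov).
move=> v a; rewrite /cop_gen (linD (lin_bill _ bOO (@lin_id _ _))).
under eq_sw => x y do rewrite (linD (lin_bilr _ bOO (@lin_id _ _))).
rewrite swDr; congr (_ + _); last first.
  transitivity (\sw_(a1, y <- cop H a) (emb_alg a1 \ox (emb_gen v ** emb_alg y))).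
    under eq_sw => x y do rewrite /cop_alg (sw_bill _ _ _ bOO).
    transitivity (\sw_(x, y <- cop H a) \sw_(x1, x2 <- cop H x)
        (emb_alg x1 \ox (emb_alg x2 ** emb_gen (xact X v y)))).
      apply: eq_sw => x y; apply: eq_sw => x1 x2.
      by rewrite [LHS](stens_mul_evenl sO) ?sgn_emb_alg // amul1r.
    rewrite -(sw_coassoc H); try by lin.
    apply: eq_sw => x y; rewrite -(sw_bilr _ _ _ (@tmul_bilinear _ _ _)).
    by rewrite (cp_cov gcov).
  rewrite /cop_alg (sw_bilr _ _ _ bOO); apply: eq_sw => x y.
  by rewrite [RHS](stens_mul_evenr sO) ?amul1l //; exact: emb_alg_even.
(* Coassociativity moves the factors a_(2) S(a_(3)) next to each other. *)
pose G (x1 x2 y1 y2 y3 : A) : tens Om Om := \sw_(v0, v1 <- xcoact X v)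
  ((emb_alg x1 ** emb_gen (xact X v0 y2)) \ox emb_alg (x2 * antipode H y1 * (v1 * y3))).
transitivity (\sw_(x, y <- cop H a) \sw_(x1, x2 <- cop H x)
  \sw_(y1, y' <- cop H y) \sw_(y2, y3 <- cop H y') G x1 x2 y1 y2 y3).
  apply: eq_sw => x y; rewrite /cop_alg (sw_bill _ _ _ bOO); apply: eq_sw => x1 x2.
  rewrite (xmod_compat crossedV) sw_sw; last by lin.
  rewrite (sw_bilr _ _ _ bOO); apply: eq_sw => y1 y'.
  rewrite sw_sw; last by lin.
  rewrite (sw_bilr _ _ _ bOO); apply: eq_sw => y2 y3.
  rewrite sw_sw; last by lin.
  rewrite (sw_bilr _ _ _ bOO); apply: eq_sw => v0 v1.
  rewrite swE; last by lin.
  rewrite [LHS](stens_mul_evenl sO) ?sgn_emb_alg // -(cp_mul gcov).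
  by rewrite !mulrA.
rewrite -(sw_coassoc H (g := fun x1 x2 y => \sw_(y1, y' <- cop H y) \sw_(y2, y3 <- cop H y')
   G x1 x2 y1 y2 y3)); try by rewrite /G; lin.
transitivity (\sw_(x1, z <- cop H a) \sw_(y2, y3 <- cop H z) \sw_(v0, v1 <- xcoact X v)
  ((emb_alg x1 ** emb_gen (xact X v0 y2)) \ox emb_alg (v1 * y3))).
  apply: eq_sw => x1 z.
  rewrite (sw_coassoc H (g := fun x2 y1 y' => \sw_(y2, y3 <- cop H y')
   G x1 x2 y1 y2 y3)); try by rewrite /G; lin.
  under eq_sw => w y'.
    rewrite (sw_antipoder H (f := fun w => \sw_(y2, y3 <- cop H y') \sw_(v0, v1 <- xcoact X v)
      ((emb_alg x1 ** emb_gen (xact X v0 y2)) \ox emb_alg (w * (v1 * y3))))); last by lin.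
    over.
  rewrite (sw_counitl H); last by lin.
  by apply: eq_sw => y2 y3; apply: eq_sw => v0 v1; rewrite mul1r.
rewrite (sw_coassoc H); try by lin.
rewrite /cop_alg (sw_bilr _ _ _ bOO); apply: eq_sw => x y3.
rewrite (sw_bill _ _ _ bOO) sw_exch; apply: eq_sw => v0 v1.
rewrite -(sw_bill _ _ _ (@tmul_bilinear _ _ _)) (cp_cov gcov).
by rewrite [RHS](stens_mul_evenl sO) ?sgn_emb_alg // -(cp_mul gcov).
Qed.

(** Invariance gives theta \ox 1 + 1 \ox theta; in its square the mixed products are theta \ox theta
    with opposite Koszul signs. *)
Lemma cop_gen_theta2 : cop_gen theta *** cop_gen theta =
  (emb_gen theta ** emb_gen theta) \ox aone OmL + aone OmL \ox (emb_gen theta ** emb_gen theta).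
Proof.
have s1 := sgn_one sO.
rewrite /cop_gen theta_inv swE; last by lin.
have -> : emb_alg 1 = aone OmL by [].
rewrite !(linD (lin_bill _ bOO (@lin_id _ _))) !(linD (lin_bilr _ bOO (@lin_id _ _))).
rewrite ![amul OmOm_law (_ \ox aone _) _](stens_mul_evenl sO) //.
rewrite ![amul OmOm_law (_ \ox emb_gen _) _](stens_mul_oddl sO) ?sgn_emb_gen //.
rewrite s1 !amul1l !amul1r linearNl -addrA; congr (_ + _).
by rewrite addrA subrr add0r.
Qed.

Lemma cop_th2_central s :
  (cop_gen theta *** cop_gen theta) *** s = s *** (cop_gen theta *** cop_gen theta).
Proof.
rewrite cop_gen_theta2; apply: (stens_central sO); first exact: emb_th2_even.
exact: emb_th2_central.
Qed.

End Coproduct.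

(** * The braided-super coproduct of the tensor algebra *)

Section BraidedSquare.
Variables (k : fieldType) (A : algType k) (H : hopf_algebra A).
Variables (V : lmodType k) (X : xmod_data A V) (crossedV : crossed_module H X).
Local Notation T := (talg V).
Local Notation act := (talg_act H X).
Local Notation coact := (talg_coact X).
Local Notation "s *b t" := (bs_tensM (talg_xmod H X) (@tpar k V) s t)
  (at level 40, left associativity).

Let bact : bilin act := talg_act_bilin crossedV.
Let lcoact : linear coact := talg_coact_lin crossedV.
Let lp := @tpar_lin k V.
Let lgen := @tgen_lin k V.

Let act0 a : act 0 a = 0 := lin0 (lin_bill a bact (@lin_id _ _)).

Let inner_bilin x y : bilin (fun z w : T =>
  \sum_(b : bool) \sum_(c : bool) (-1) ^+ (b && c) *:
     \sw_(z', y' <- braid (talg_xmod H X) (talg_xmod H X) (tpar b y) (tpar c z))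
        ((x * z') \ox (y' * w))).
Proof. by rewrite /braid /=; lin. Qed.

Lemma braided_mul_bilin : bilin (bs_tensM (talg_xmod H X) (@tpar k V)).
Proof. by have h := inner_bilin; rewrite /bs_tensM /braid /=; lin. Qed.

Lemma braided_mulE x y z w : (x \ox y) *b (z \ox w) =
  \sum_(b : bool) \sum_(c : bool) (-1) ^+ (b && c) *:
    \sw_(z0, z1 <- coact (tpar c z)) ((x * z0) \ox (act (tpar b y) z1 * w)).
Proof.
have h := inner_bilin; rewrite /bs_tensM swE; last by rewrite /braid /=; lin.
rewrite swE //; apply: eq_bigr => b _; apply: eq_bigr => c _; congr (_ *: _).
rewrite /braid /= sw_sw; last by lin.
by apply: eq_sw => z0 z1; rewrite swE //; lin.
Qed.

(** Braiding past 1 is trivial: 1 is even and A acts on it by the counit, which absorbs the coaction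
    of x. *)
Lemma braided_mul_genl v x y : (tgen v \ox 1) *b (x \ox y) = (tgen v * x) \ox y.
Proof.
rewrite braided_mulE !big_bool /= !tpar1 /= !expr0 !scale1r.
have e c : \sw_(z0, z1 <- coact (tpar c x)) ((tgen v * z0) \ox (act 1 z1 * y))
  = (tgen v * tpar c x) \ox y.
  under eq_sw do rewrite (talg_act1 crossedV) mulr_algl linearZr /=.
  by rewrite (sw_xcounit (talg_coact_counit crossedV (tpar c x))); last by lin.
rewrite !e sw0; last by move=> z0 z1; rewrite act0 mul0r linear0r.
rewrite sw0; last by move=> z0 z1; rewrite act0 mul0r linear0r.
by rewrite scaler0 !add0r -linearDl -mulrDr addrC tpar_sum.
Qed.

(** v is odd, so the sign is decided by the parity c of x; the braiding moves v past x and lets the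
    coaction leg x_1 act on it. *)
Lemma braided_mul_genr v x y : (1 \ox tgen v) *b (x \ox y) =
  \sum_(c : bool) (-1) ^+ c *:
    \sw_(x0, x1 <- coact (tpar c x)) (x0 \ox (tgen (xact X v x1) * y)).
Proof.
rewrite braided_mulE !big_bool /= !tpar_gen /=.
have e c : \sw_(z0, z1 <- coact (tpar c x)) ((1 * z0) \ox (act (tgen v) z1 * y))
  = \sw_(x0, x1 <- coact (tpar c x)) (x0 \ox (tgen (xact X v x1) * y)).
  by apply: eq_sw => z0 z1; rewrite mul1r (talg_act_gen crossedV).
have e0 c : \sw_(z0, z1 <- coact (tpar c x)) ((1 * z0) \ox (act 0 z1 * y)) = 0.
  by apply: sw0 => z0 z1; rewrite act0 mul0r linear0r.
by rewrite !e !e0 !scaler0 !addr0.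
Qed.

Let cop_step (v : V) (t : tens T T) : tens T T := (tgen v \ox 1 + 1 \ox tgen v) *b t.

Let cop_step_bilin : bilin cop_step.
Proof. by have h := braided_mul_bilin; rewrite /cop_step; lin. Qed.

Let word_cop_mult : multilinear (word_cop H X).
Proof. exact: (multilinear_rec cop_step_bilin). Qed.

Lemma talg_cop_lin : linear (talg_cop H X).
Proof. exact: text_linear word_cop_mult. Qed.

Lemma talg_cop1 : talg_cop H X 1 = 1 \ox 1.
Proof. exact: textE word_cop_mult [::]. Qed.

Lemma talg_cop_cons v x : talg_cop H X (tgen v * x) =
  (tgen v \ox 1) *b talg_cop H X x + (1 \ox tgen v) *b talg_cop H X x.
Proof.
have h := braided_mul_bilin.
rewrite [LHS](text_rec cop_step_bilin) // /cop_step.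
exact: (linD (lin_bill _ h (@lin_id _ _))).
Qed.

(** Lets x, and hence its coaction, be recovered from its coproduct. In the recursion the summand 1
    \ox v dies, as it leaves a generator in the right factor. *)
Lemma talg_cop_counit x : \sw_(y, z <- talg_cop H X x) ((tcounit z : k) *: y) = x.
Proof.
have lc : linear (@tcounit k V) := @lin_fun _ _ _ _.
have lcop := talg_cop_lin; have bm := braided_mul_bilin.
have bk : bilin (fun y z : T => (tcounit z : k) *: y) by lin.
move: x; apply: (talg_eq_ind (I := unit) (g := fun _ x => x)
  (f := fun _ x => \sw_(y, z <- talg_cop H X x) ((tcounit z : k) *: y))) => //.
- by move=> _; lin.
- by move=> _; rewrite talg_cop1 swE // tcounit1 scale1r.
move=> v x /(_ tt) IH _; rewrite talg_cop_cons swD //.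
have e1 t : \sw_(y, z <- (tgen v \ox 1) *b t) ((tcounit z : k) *: y) =
    tgen v * \sw_(y, z <- t) ((tcounit z : k) *: y).
  move: t; apply: tens_ext => [||y z]; [by lin | by lin |].
  by rewrite braided_mul_genl !swE // scalerAr.
have e2 t : \sw_(y, z <- (1 \ox tgen v) *b t) ((tcounit z : k) *: y) = 0.
  move: t; apply: tens_ext => [||y z]; [by lin | by lin |].
  rewrite braided_mul_genr (linS (tlift_linear bk)) big1 // => c _.
  rewrite (linZ (tlift_linear bk)) sw_sw // sw0 ?scaler0 // => x0 x1.
  by rewrite swE // tcounitM tcounit_gen mul0r scale0r.
by rewrite e1 e2 IH addr0.
Qed.

End BraidedSquare.

(** * Descent of coproduct and coaction to Lambda_theta *)

Section Coproduct.
Variables (k : fieldType) (A : algType k) (H : hopf_algebra A).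
Variables (V : lmodType k) (X : xmod_data A V) (crossedV : crossed_module H X).
Variable theta : V.
Hypothesis theta_inv : xcoact X theta = theta \ox 1.
Local Notation T := (talg V).
Local Notation Lam := (lam H X theta).
Local Notation pi := (@lam_pi k A H V X theta).
Local Notation L := (Lambda_theta H X theta).
Local Notation Om := (tens A Lam).
Local Notation OmL := (Omega_law crossedV theta).
Local Notation par := (smash_par (L := L)).
Local Notation "s ** t" := (amul OmL s t) (at level 40, left associativity).
Local Notation OOL := (OmOm_law crossedV theta).
Local Notation "s *** t" := (amul OOL s t) (at level 40, left associativity).
Local Notation emb_alg := (@emb_alg k A H V X theta).
Local Notation emb_gen := (@emb_gen k A H V X theta).
Local Notation act := (talg_act H X).
Local Notation coact := (talg_coact X).
Local Notation cop_alg := (@cop_alg k A H V X theta).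
Local Notation cop_gen := (@cop_gen k A H V X crossedV theta).

Let sO : super_law OmL par := Omega_super crossedV theta.
Let gcov : covariant_pair H X OmL emb_alg emb_gen := Omega_covariant crossedV theta.
Let ccov : covariant_pair H X OOL cop_alg cop_gen := cop_covariant crossedV theta.
Let lemb_alg : linear emb_alg := cp_linl gcov.
Let lemb_gen : linear emb_gen := cp_linr gcov.
Let bO : bilin (amul OmL) := amul_bilin OmL.
Let bOO : bilin (amul OOL) := amul_bilin OOL.
Let bX := xact_bilinear crossedV.
Let lX := xcoact_linear crossedV.
Let lpi := @lam_pi_lin k A H V X theta.
Let lgen := @tgen_lin k V.
Let lp := @tpar_lin k V.
Let lcoact : linear coact := talg_coact_lin crossedV.
Let lcop : linear (talg_cop H X) := talg_cop_lin crossedV.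
Let ext := alg_ext OOL cop_gen.
Let lext : linear ext := alg_ext_lin ccov.

(* This map x \ox y |-> x_0 \ox x_1 y turns the braided-super square into the super
   square of Omega.  Modulo the ideal it is inverted by counits, which is how the
   coproduct and the coaction are seen to descend to Lambda_theta. *)
Definition bosonize (t : tens T T) : tens Om Om :=
  \sw_(x, y <- t) \sw_(x0, x1 <- coact x) ((1 \ox pi x0) \ox (x1 \ox pi y)).

Lemma bosonizeE x y : bosonize (x \ox y) =
  \sw_(x0, x1 <- coact x) ((1 \ox pi x0) \ox (x1 \ox pi y)).
Proof. by rewrite /bosonize swE //; lin. Qed.

Lemma bosonize_lin : linear bosonize.
Proof. by rewrite /bosonize; lin. Qed.

Lemma smash_par_pi b a x : par b (a \ox pi x) = a \ox pi (tpar b x).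
Proof.
have l := par_lin (Lambda_super crossedV theta) b.
by rewrite [LHS]tmapE //= lam_par_pi.
Qed.

(** [bosonize] turns braided multiplication by v \ox 1 and 1 \ox v into super multiplication by the
    two summands of [cop_gen v]; so after it the braided coproduct is the algebra map extending
    [cop_gen]. *)
Lemma bosonize_talg_cop x : bosonize (talg_cop H X x) = ext x.
Proof.
have lbosonize := bosonize_lin; have bm := braided_mul_bilin crossedV.
move: x; apply: (talg_eq_ind (I := unit) (f := fun _ x => bosonize (talg_cop H X x))
  (g := fun _ => ext)) => //.
- by move=> _; lin.
- move=> _; rewrite (talg_cop1 crossedV) bosonizeE (talg_coact1 crossedV).
  by rewrite swE; [rewrite [RHS](alg_ext1 ccov) | lin].
move=> v x /(_ tt) IH _; rewrite (talg_cop_cons crossedV) (linD lbosonize).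
rewrite [RHS](alg_ext_cons ccov) -/ext -IH (linD (lin_bill _ bOO (@lin_id _ _))).
congr (_ + _); move: (talg_cop H X x).
  apply: tens_ext => [||y z]; [by lin | by lin |].
  rewrite (braided_mul_genl crossedV) !bosonizeE (sw_talg_coact_cons crossedV); last by lin.
  rewrite (sw_bill _ _ _ bOO); apply: eq_sw => v0 v1.
  rewrite (sw_bilr _ _ _ bOO); apply: eq_sw => x0 x1.
  rewrite [RHS](stens_mul_evenl sO) ?sgn_emb_alg //; congr (_ \ox _).
    by rewrite lam_piM; symmetry; apply: (smash_mul_coef (Lambda_module_algebra crossedV theta)).
  by symmetry; apply: (smash_mul_algl (Lambda_module_algebra crossedV theta)).
apply: tens_ext => [||y z]; [by lin | by lin |].
rewrite (braided_mul_genr crossedV) bosonizeE (sw_bilr _ _ _ bOO) (linS lbosonize).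
(* The alternating sum over c is the sign automorphism on the left factor, which is what multiplying
   by an odd right leg produces. *)
transitivity (\sw_(y0, y1 <- coact y) \sum_(c : bool) (-1) ^+ c *:
  (((1 : A) \ox pi (tpar c y0)) \ox (emb_gen v ** (y1 \ox pi z)))); last first.
  apply: eq_sw => y0 y1; rewrite big_bool /= expr0 scale1r expr1 scaleN1r.
  rewrite [RHS](stens_mul_oddl sO) ?sgn_emb_gen // amul1l /sgn !smash_par_pi.
  by rewrite linearBl addrC.
rewrite sw_sum; apply: eq_bigr => c _.
rewrite -sw_scale (linZ lbosonize) (sw_lin _ _ lbosonize); congr (_ *: _).
rewrite (talg_coact_par crossedV) sw_tmap; last by lin.
(* [bosonize] coacts again on y0, whereas the smash product splits y1 by the coproduct;
   coassociativity of the coaction identifies the two. *)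
transitivity (\sw_(y0, y1 <- coact y) \sw_(a1, a2 <- cop H y1)
  (((1 : A) \ox pi (tpar c y0)) \ox (a1 \ox pi (tgen (xact X v a2) * z)))).
  rewrite (sw_xcoassoc lcoact (talg_coact_coassoc crossedV y)); try by lin.
  apply: eq_sw => y0 y1; rewrite bosonizeE (talg_coact_par crossedV) sw_tmap //; lin.
apply: eq_sw => y0 y1; rewrite [amul _ _ _]smash_mulE; last exact: Lambda_module_algebra.
rewrite (sw_bilr _ _ _ (@tmul_bilinear _ _ _)); apply: eq_sw => a1 a2.
by rewrite mul1r /= lam_act_pi // (talg_act_gen crossedV) lam_piM.
Qed.

Lemma ext_theta_ideal x : theta_ideal H X theta x -> ext x = 0.
Proof.
move=> hx; apply: (alg_ext_kill crossedV ccov _ _ hx) => y; exact: cop_th2_central.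
Qed.

Definition eps_l (s : Om) : Lam := \sw_(a, x <- s) ((counit H a : k) *: x).

Lemma eps_l_lin : linear eps_l.
Proof. by rewrite /eps_l; lin. Qed.

(** Applying the counit of A in both factors of [bosonize t] removes the coaction leg and leaves the
    image of t; on a coproduct [bosonize] gives [ext], which kills the ideal. *)
Lemma talg_cop_ideal x : theta_ideal H X theta x -> tmap pi pi (talg_cop H X x) = 0.
Proof.
move=> hx; have le := eps_l_lin; have lb := bosonize_lin.
have lt : linear (tmap pi pi) by apply: tmap_lin.
suff E t : tmap eps_l eps_l (bosonize t) = tmap pi pi t.
  by rewrite -E bosonize_talg_cop (ext_theta_ideal hx) (lin0 (tmap_lin le le)).
have lte : linear (tmap eps_l eps_l) by apply: tmap_lin.
have eE a y : eps_l (a \ox pi y) = (counit H a : k) *: pi y by rewrite /eps_l swE //; lin.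
move: t; apply: tens_ext => [||y z]; [by lin | by lin |].
rewrite bosonizeE tmapE // (sw_lin _ _ lte).
under eq_sw => y0 y1.
  rewrite tmapE // !eE rmorph1 scale1r linearZr.
  over.
by rewrite (sw_xcounit (talg_coact_counit crossedV y)) //; lin.
Qed.

(** The counit of [Lambda_theta] is read off a representative, which is harmless since [tcounit]
    vanishes on the ideal. *)
Definition eps_r (s : Om) : A := \sw_(a, x <- s) ((tcounit (lam_repr x) : k) *: a).

(** Killing A on the left and [Lambda_theta] on the right of [bosonize (y \ox z)] leaves the
    coaction of y times the counit of z. So on a coproduct the coaction is obtained from [ext],
    which kills the ideal. *)
Lemma talg_coact_ideal x : theta_ideal H X theta x -> tmap pi id (coact x) = 0.
Proof.
move=> hx; have le := eps_l_lin; have lb := bosonize_lin.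
have tc y : tcounit (lam_repr (pi y)) = tcounit y.
  apply/eqP; rewrite -subr_eq0 -linearB; apply/eqP.
  by apply: (@theta_ideal_counit k A H V X theta); exact: lam_repr_pi.
have ltc : linear (fun x : Lam => tcounit (lam_repr x)).
  by move=> a; elim/lamW=> y; elim/lamW=> z; rewrite -lpi !tc linearP.
have lr : linear eps_r by rewrite /eps_r; lin.
have lt : linear (tmap pi (id : A -> A)) by apply: tmap_lin.
have lte : linear (tmap eps_l eps_r) by apply: tmap_lin.
suff E t : tmap eps_l eps_r (bosonize t) =
    tmap pi id (coact (\sw_(y, z <- t) ((tcounit z : k) *: y))).
  by rewrite -[x](talg_cop_counit crossedV) -E bosonize_talg_cop (ext_theta_ideal hx) (lin0 lte).
have leE a y : eps_l (a \ox pi y) = (counit H a : k) *: pi y by rewrite /eps_l swE //; lin.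
have erE a y : eps_r (a \ox pi y) = (tcounit y : k) *: a by rewrite /eps_r swE ?tc //; lin.
have lcv : linear (@tcounit k V) := @lin_fun _ _ _ _.
move: t; apply: tens_ext => [||y z]; [by lin | by lin |].
rewrite swE; last by lin.
rewrite bosonizeE (linZ lcoact) (linZ lt) (sw_lin _ _ lte) -[coact y in RHS]sw_tens.
rewrite (sw_lin _ _ lt) sw_scale; apply: eq_sw => y0 y1.
by rewrite !tmapE // leE erE rmorph1 scale1r linearZr.
Qed.

Lemma lam_cop_pi x : lam_cop (pi x) = tmap pi pi (talg_cop H X x).
Proof.
have lt : linear (tmap pi pi) by apply: tmap_lin.
apply/eqP; rewrite -subr_eq0 -(linB lt) -(linB lcop); apply/eqP.
by apply: talg_cop_ideal; exact: lam_repr_pi.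
Qed.

Lemma lam_coact_pi x : lam_coact (pi x) = tmap pi id (coact x).
Proof.
have lt : linear (tmap pi (id : A -> A)) by apply: tmap_lin.
apply/eqP; rewrite -subr_eq0 -(linB lt) -(linB lcoact); apply/eqP.
by apply: talg_coact_ideal; exact: lam_repr_pi.
Qed.

(** Evaluating on pure tensors reduces this to [bosonize_talg_cop]. The right side is multiplicative
    by [smash_extM], so the coproduct of Omega is too. *)
Lemma smash_copE s : smash_cop H (L := L) s = @smash_ext k A H V X _ OOL cop_alg cop_gen theta s.
Proof.
have lc : linear (@lam_cop k A H V X theta).
  have lt : linear (tmap pi pi) by apply: tmap_lin.
  by move=> a; elim/lamW=> y; elim/lamW=> z; rewrite -lpi !lam_cop_pi lcop lt.
have ld : linear (@lam_coact k A H V X theta).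
  have lt : linear (tmap pi (id : A -> A)) by apply: tmap_lin.
  by move=> a; elim/lamW=> y; elim/lamW=> z; rewrite -lpi !lam_coact_pi lcoact lt.
have le : linear (@smash_ext k A H V X _ OOL cop_alg cop_gen theta).
  by apply: (smash_ext_lin crossedV ccov) => y; exact: cop_th2_central.
have lbosonize := bosonize_lin.
have ls : linear (smash_cop H (L := L)) by rewrite /smash_cop /=; lin.
move: s; apply: tens_ext => // a; elim/lamW=> x.
rewrite (smash_extE crossedV ccov); try by move=> y; exact: cop_th2_central.
rewrite -/ext -bosonize_talg_cop [LHS]/smash_cop [LHS]/= [LHS]swE; last by lin.
rewrite lam_cop_pi /cop_alg (sw_bill _ _ _ bOO); apply: eq_sw => a1 a2.
rewrite sw_tmap; last by lin.
rewrite /bosonize (sw_bilr _ _ _ bOO); apply: eq_sw => y z.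
rewrite lam_coact_pi sw_tmap; last by lin.
rewrite (sw_bilr _ _ _ bOO); apply: eq_sw => y0 y1.
rewrite [RHS](stens_mul_evenl sO) ?sgn_emb_alg //; congr (_ \ox _); symmetry.
  rewrite -[a1 in RHS]mulr1.
  exact: (smash_mul_algl (Lambda_module_algebra crossedV theta)).
exact: (smash_mul_algl (Lambda_module_algebra crossedV theta)).
Qed.

End Coproduct.

(** * The augmentation *)

Section Augmentation.
Variables (k : fieldType) (A : algType k) (H : hopf_algebra A).
Variables (V : lmodType k) (X : xmod_data A V) (crossedV : crossed_module H X).
Variable theta : V.
Hypothesis theta_inv : xcoact X theta = theta \ox 1.
Variable i : V -> A.
Hypothesis i_lin : linear i.
Hypothesis i_act : forall v a,
  i (xact X v a) = \sw_(b1, b2 <- cop H a) (antipode H b1 * i v * b2).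
Hypothesis i_coact : forall v, cop H (i v) = tmap i id (xcoact X v) + 1 \ox i v.

Local Notation Lam := (lam H X theta).
Local Notation pi := (@lam_pi k A H V X theta).
Local Notation L := (Lambda_theta H X theta).
Local Notation Om := (tens A Lam).
Local Notation OmL := (Omega_law crossedV theta).
Local Notation par := (smash_par (L := L)).
Local Notation "s ** t" := (amul OmL s t) (at level 40, left associativity).
Local Notation OOL := (OmOm_law crossedV theta).
Local Notation "s *** t" := (amul OOL s t) (at level 40, left associativity).
Local Notation emb_alg := (@emb_alg k A H V X theta).
Local Notation emb_gen := (@emb_gen k A H V X theta).
Local Notation cop_alg := (@cop_alg k A H V X theta).
Local Notation cop_gen := (@cop_gen k A H V X crossedV theta).

Let sO : super_law OmL par := Omega_super crossedV theta.
Let gcov : covariant_pair H X OmL emb_alg emb_gen := Omega_covariant crossedV theta.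
Let ccov : covariant_pair H X OOL cop_alg cop_gen := cop_covariant crossedV theta.
Let lemb_alg : linear emb_alg := cp_linl gcov.
Let lemb_gen : linear emb_gen := cp_linr gcov.
Let bO : bilin (amul OmL) := amul_bilin OmL.
Let bOO : bilin (amul OOL) := amul_bilin OOL.
Let bX := xact_bilinear crossedV.
Let lX := xcoact_linear crossedV.

Local Notation om := (emb_gen (xact X theta (i theta))).

Lemma i_theta_comm : emb_alg (i theta) ** emb_gen theta - emb_gen theta ** emb_alg (i theta) = - om.
Proof.
rewrite -(cp_cov gcov) i_coact theta_inv tmapE // swD; last by lin.
rewrite !swE; try by lin.
rewrite (xact1 crossedV) (cp_one gcov) amul1l.
by rewrite opprD addrA subrr add0r.
Qed.

Hypothesis om_central : forall y, om ** y = sgn par y ** om.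

Definition aug_alg (a : A) : Om * Om := (emb_alg a, 0).
Definition aug_gen (v : V) : Om * Om := (emb_gen v, emb_alg (i v)).

Local Notation EL := (skew_law sO).
Local Notation "p *e q" := (amul EL p q) (at level 40, left associativity).

(** In the second component the cross relation reads a_1 i(v <| a_2) = i(v) a; by the adjoint form
    of the action on A^+ this is the cancellation of a_1 S(a_2). *)
Lemma aug_covariant : covariant_pair H X EL aug_alg aug_gen.
Proof.
split.
- by apply: lin_pair; lin.
- by apply: lin_pair; lin.
- by [].
- move=> a b; rewrite /aug_alg skew_lawE amul0l amul0r addr0.
  by rewrite (cp_mul gcov).
move=> v a; rewrite [RHS]skew_lawE.
rewrite [LHS]surjective_pairing (sw_lin _ _ (lin_fst (@lin_id _ _))).
rewrite (sw_lin _ _ (lin_snd (@lin_id _ _))).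
congr pair; first exact: (cp_cov gcov).
rewrite amul0r addr0 -(cp_mul gcov).
have e b w : (aug_alg b *e aug_gen w).2 = emb_alg b ** emb_alg (i w).
  rewrite skew_law2 -/(emb_alg b) [(aug_alg b).2]/(0) amul0l add0r.
  by rewrite [(aug_alg b).1]/(emb_alg b) (sgn_emb_alg crossedV).
under eq_sw => a1 a2 do rewrite e -(cp_mul gcov) i_act sw_mulr.
rewrite -(sw_lin _ _ lemb_alg); congr emb_alg.
rewrite (sw_coassoc H); try by lin.
under eq_sw => x y.
  under eq_sw do rewrite !mulrA.
  rewrite (sw_antipoder H (f := fun b => b * i v * y)); last by lin.
  over.
by rewrite (sw_counitl H) ?mul1r //; lin.
Qed.
Let acov := aug_covariant.

Lemma aug_theta2 : aug_gen theta *e aug_gen theta = (emb_gen theta ** emb_gen theta, - om).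
Proof.
rewrite skew_lawE; congr pair.
by rewrite (sgn_emb_gen crossedV) amulNl i_theta_comm.
Qed.

(** In the second components theta^2 i(v) and i(v) theta^2 agree, and what is left is that theta <|
    i(theta) anticommutes with v. *)
Lemma aug_comm_g v :
  aug_gen theta *e aug_gen theta *e aug_gen v = aug_gen v *e (aug_gen theta *e aug_gen theta).
Proof.
have st : sgn par (emb_gen theta ** emb_gen theta) = emb_gen theta ** emb_gen theta.
  by apply: (even_sgn sO); exact: emb_th2_even.
rewrite aug_theta2 !skew_lawE st (sgn_emb_gen crossedV) !emb_th2_central; congr pair.
by rewrite amulNl om_central (sgn_emb_gen crossedV) !amulNl amulNr !opprK addrC.
Qed.

Lemma aug_comm_a a :
  aug_gen theta *e aug_gen theta *e aug_alg a = aug_alg a *e (aug_gen theta *e aug_gen theta).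
Proof.
rewrite aug_theta2 !skew_lawE (sgn_emb_alg crossedV) emb_th2_central; congr pair.
by rewrite amul0r amul0l addr0 add0r amulNl amulNr om_central (sgn_emb_alg crossedV).
Qed.

Definition aug_ext : Om -> Om * Om := @smash_ext k A H V X _ EL aug_alg aug_gen theta.
Definition aug (s : Om) : Om := (aug_ext s).2.

Lemma aug_ext_lin : linear aug_ext.
Proof. exact: (smash_ext_lin crossedV acov aug_comm_g aug_comm_a). Qed.

Lemma aug_lin : linear aug.
Proof. exact: (lin_snd aug_ext_lin). Qed.

Lemma aug_extM s t : aug_ext (s ** t) = aug_ext s *e aug_ext t.
Proof. exact: (smash_extM crossedV acov aug_comm_g aug_comm_a). Qed.

Lemma aug_ext_alg a : aug_ext (emb_alg a) = aug_alg a.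
Proof.
rewrite [LHS](smash_extE crossedV acov aug_comm_g aug_comm_a).
by rewrite (alg_ext1 acov) amul1r.
Qed.

Lemma aug_ext_gen v : aug_ext (emb_gen v) = aug_gen v.
Proof.
rewrite [LHS](smash_extE crossedV acov aug_comm_g aug_comm_a).
by rewrite (alg_ext_gen acov) (cp_one acov) amul1l.
Qed.

(** The first component is an algebra map fixing the generators; once it is the identity,
    multiplicativity of the pair is the super-derivation rule for [aug]. *)
Lemma aug_ext_fst s : (aug_ext s).1 = s.
Proof.
have l1 := lin_fst aug_ext_lin.
move: s; apply: (Omega_ind (crossedV := crossedV)) => [c s t hs ht||a s hs|v s hs].
- by rewrite l1 hs ht.
- by rewrite -(cp_one gcov) aug_ext_alg.
- by rewrite aug_extM skew_law1 aug_ext_alg hs.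
- by rewrite aug_extM skew_law1 aug_ext_gen hs.
Qed.

Lemma augM s t : aug (s ** t) = aug s ** t + sgn par s ** aug t.
Proof. by rewrite /aug aug_extM skew_law2 !aug_ext_fst. Qed.

Lemma aug_emb_alg a : aug (emb_alg a) = 0.
Proof. by rewrite /aug aug_ext_alg. Qed.

Lemma aug_emb_gen v : aug (emb_gen v) = emb_alg (i v).
Proof. by rewrite /aug aug_ext_gen. Qed.

Lemma aug_one : aug (aone OmL) = 0.
Proof. by rewrite -(cp_one gcov) aug_emb_alg. Qed.

Lemma aug_alg_mul a s : aug (emb_alg a ** s) = emb_alg a ** aug s.
Proof. by rewrite augM aug_emb_alg amul0l add0r (sgn_emb_alg crossedV). Qed.

Lemma aug_gen_mul v s : aug (emb_gen v ** s) = emb_alg (i v) ** s - emb_gen v ** aug s.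
Proof. by rewrite augM aug_emb_gen (sgn_emb_gen crossedV) amulNl. Qed.

(** Oddness of [aug], the condition under which its extension to the super tensor square is a
    super-derivation. *)
Lemma aug_par c s : aug (par c s) = par (~~ c) (aug s).
Proof.
have la := aug_lin; have lp := par_lin sO.
move: s c; apply: (Omega_ind (crossedV := crossedV)) => [a s t hs ht|b|a s hs b|v s hs b].
- by move=> b; rewrite !(la, lp) hs ht.
- rewrite (par_one sO) aug_one (lin0 (lp _)).
  by case: b; rewrite ?aug_one ?(lin0 la).
- rewrite (par_mul_even sO); last exact: emb_alg_even.
  rewrite !aug_alg_mul hs (par_mul_even sO) //; exact: emb_alg_even.
rewrite (par_mul_odd sO); last exact: emb_gen_odd.
rewrite !aug_gen_mul hs (linB (lp _)) negbK.
rewrite (par_mul_even sO) ?(par_mul_odd sO) ?negbK //; last exact: emb_alg_even.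
exact: emb_gen_odd.
Qed.

(** On v s the two mixed terms i(v) aug(s) cancel, because [aug] changes sign when it passes v and
    is linear over A. *)
Lemma aug_aug s : aug (aug s) = 0.
Proof.
have la := aug_lin.
move: s; apply: (Omega_ind (crossedV := crossedV)) => [c s t hs ht||a s hs|v s hs].
- by rewrite !la hs ht scaler0 addr0.
- by rewrite aug_one (lin0 la).
- by rewrite !aug_alg_mul hs amul0r.
- by rewrite aug_gen_mul (linB la) aug_alg_mul aug_gen_mul hs amul0r subr0 subrr.
Qed.

Local Notation deg := (smash_deg (L := L)).

Lemma aug_tword_deg w : deg (size w).-1 (aug (1 \ox pi (tword w))).
Proof.
have mL := Lambda_module_algebra crossedV theta.
elim: w => [|v w IH]; first by rewrite [aug _]aug_one; apply: smash_deg0.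
rewrite tword_cons lam_piM -(smash_mul_coef mL) [aug _]aug_gen_mul -scaleN1r addrC.
apply: smash_degD.
  case: w IH => [|v' w] IH; last by apply: smash_degZ; exact: (smash_deg_gen crossedV v IH).
  by rewrite [aug _]aug_one amul0r scaler0; apply: smash_deg0.
apply: smash_deg_alg; apply: smash_deg_pure; exists (tword w); split=> //.
by exists [:: (1, w)]; rewrite big_seq1 scale1r /= eqxx.
Qed.

Lemma aug_pure_deg n a t : tdeg n t -> deg n.-1 (aug (a \ox pi t)).
Proof.
have la := aug_lin; have lpi := @lam_pi_lin k A H V X theta.
move=> [q [/allP hq ->]]; rewrite (linS lpi) (linS (lin_tmulr a (@lin_id _ _))) (linS la) big_seq.
apply: big_ind => [||[c w] /hq /eqP /= <-]; [exact: smash_deg0 | by move=> *; apply: smash_degD |].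
rewrite (linZ lpi) (linZ (lin_tmulr a (@lin_id _ _))) (linZ la); apply: smash_degZ.
rewrite -[a]mulr1 -(smash_mul_algl (Lambda_module_algebra crossedV theta)) [aug _]aug_alg_mul.
by apply: smash_deg_alg; exact: aug_tword_deg.
Qed.

Lemma aug_deg_pred n s : deg n s -> deg n.-1 (aug s).
Proof.
have la := aug_lin; move=> [r [hr ->]]; rewrite (linS la) big_seq.
apply: big_ind => [||[a x] /hr /= [t [ht ->]]];
  [exact: smash_deg0 | by move=> *; apply: smash_degD |].
exact: aug_pure_deg.
Qed.

Lemma aug_deg_zero s : deg 0 s -> aug s = 0.
Proof.
have la := aug_lin; have lpi := @lam_pi_lin k A H V X theta.
move=> [r [hr ->]]; rewrite (linS la) big_seq big1 // => -[a x] /hr /= [t [[q [/allP hq ->]] ->]].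
rewrite (linS lpi) (linS (lin_tmulr a (@lin_id _ _))) (linS la) big_seq big1 // => -[c w] /hq /=.
case: w => //= _; rewrite (linZ lpi) (linZ (lin_tmulr a (@lin_id _ _))) (linZ la).
rewrite [aug _]aug_emb_alg.
by rewrite scaler0.
Qed.

Let Cop := @smash_ext k A H V X _ OOL cop_alg cop_gen theta.

(** Along the algebra map [Cop] both sides have the same behaviour under left multiplication by a
    generator, so only A and V remain. The signs there come from [cop_alg a] being even and
    [cop_gen v] odd. *)
Lemma aug_cop s : smash_cop H (L := L) (aug s) =
  tmap aug id (smash_cop H (L := L) s) + tmap (sgn par) aug (smash_cop H (L := L) s).
Proof.
have la := aug_lin.
have lc : linear (Cop).
  by apply: (smash_ext_lin crossedV ccov) => y; exact: cop_th2_central.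
have hcop t : smash_cop H (L := L) t = Cop t.
  exact: smash_copE.
rewrite !hcop -/(skew_coder par aug _).
have ld := skew_coder_lin sO la.
have cM t u : Cop (t ** u) =
    Cop t *** Cop u.
  by apply: (smash_extM crossedV ccov) => y; exact: cop_th2_central.
have ca a : Cop (emb_alg a) = cop_alg a.
  rewrite [LHS](smash_extE crossedV ccov); try by move=> y; exact: cop_th2_central.
  by rewrite (alg_ext1 ccov) amul1r.
have cg v : Cop (emb_gen v) = cop_gen v.
  rewrite [LHS](smash_extE crossedV ccov); try by move=> y; exact: cop_th2_central.
  by rewrite (alg_ext_gen ccov) (cp_one ccov) amul1l.
have ls := sgn_lin sO.
have lss : linear (tmap (sgn par) (sgn par)) by apply: tmap_lin.
have Dm t u : skew_coder par aug (t *** u) =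
    skew_coder par aug t *** u + tmap (sgn par) (sgn par) t *** skew_coder par aug u.
  exact: (skew_coder_mul sO la aug_par augM).
have Da a : skew_coder par aug (cop_alg a) = 0.
  rewrite /cop_alg (sw_lin _ _ ld) sw0 // => a1 a2.
  by rewrite (skew_coderE sO la) !aug_emb_alg linear0l linear0r addr0.
have Sa a : tmap (sgn par) (sgn par) (cop_alg a) = cop_alg a.
  rewrite /cop_alg (sw_lin _ _ lss); apply: eq_sw => a1 a2.
  by rewrite tmapE // !(sgn_emb_alg crossedV).
(* On v the extended derivation gives i(v_0) \ox v_1 + 1 \ox i(v), and colinearity of i says that
   this is the coproduct of i(v). *)
have Dg v : skew_coder par aug (cop_gen v) = cop_alg (i v).
  rewrite /cop_gen (linD ld) (sw_lin _ _ ld) (skew_coderE sO la) aug_one aug_emb_gen (sgn_one sO).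
  rewrite linear0l add0r /cop_alg i_coact swD; last by lin.
  rewrite swE; last by lin.
  congr (_ + _); rewrite sw_tmap; last by lin.
  apply: eq_sw => v0 v1.
  by rewrite (skew_coderE sO la) aug_emb_alg aug_emb_gen linear0r addr0.
have Sg v : tmap (sgn par) (sgn par) (cop_gen v) = - cop_gen v.
  rewrite /cop_gen (linD lss) (sw_lin _ _ lss) tmapE // (sgn_one sO) (sgn_emb_gen crossedV).
  rewrite opprD linearNr -(linN (@lin_id _ _)) (sw_lin _ _ (lin_opp (@lin_id _ _))); congr (_ + _).
  by apply: eq_sw => v0 v1; rewrite tmapE // (sgn_emb_alg crossedV) (sgn_emb_gen crossedV) linearNl.
move: s; apply: (Omega_ind (crossedV := crossedV)) => [c s t hs ht||a s hs|v s hs].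
- by rewrite la !lc ld hs ht.
- by rewrite -(cp_one gcov) aug_emb_alg ca Da (lin0 lc).
- rewrite aug_alg_mul !cM hs ca Dm Da Sa.
  by rewrite amul0l add0r.
rewrite aug_gen_mul (linB lc) !cM hs ca cg Dm Dg Sg.
by rewrite amulNl.
Qed.

End Augmentation.

Theorem proposition4p5 (k : fieldType) (chark : 2%N \notin [pchar k])
    (A : algType k) (H : hopf_algebra A) (S_bij : bijective (antipode H))
    (V : lmodType k) (X : xmod_data A V) (crossedV : crossed_module H X)
    (theta : V) (theta_inv : xcoact X theta = theta \ox 1)
    (i : {linear V -> Aplus H})
    (i_crossed : crossed_module_map X (Aplus_xmod H) i) :
  augmented_by H X theta (fun v => Aplus_val (i v))
  <-> @graded_central k (Omega_theta H X theta)
        (Omega1 H X theta 1 (xact X theta (Aplus_val (i theta)))).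
Proof.
pose OmL := Omega_law crossedV theta.
pose par := smash_par (L := Lambda_theta H X theta).
pose i' v := Aplus_val (i v).
have i_lin : linear i' by move=> a v w; rewrite /i' linearP.
have i_act v a : i' (xact X v a) = \sw_(b1, b2 <- cop H a) (antipode H b1 * i' v * b2).
  by rewrite /i' i_crossed.1.
(* The coaction on A^+ is the coproduct minus 1 \ox a; colinearity is used with that term moved
   across. *)
have i_coact v : cop H (i' v) = tmap i' id (xcoact X v) + 1 \ox i' v.
  apply/eqP; rewrite -subr_eq; apply/eqP; rewrite -[LHS]Aplus_coactE.
  have -> : Aplus_coact (i v) = tmap i id (xcoact X v) by exact: i_crossed.2.
  rewrite [LHS]sw_tmap //; exact: tmap_bilinear.
have sO : super_law OmL par := Omega_super crossedV theta.
pose om := emb_gen H X theta (xact X theta (i' theta)).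
have centralE : @graded_central k (Omega_theta H X theta) om <->
    forall y, amul OmL om y = amul OmL (sgn par y) om.
  have e y : scomm (amul OmL) par om y = _ := scomm_odd sO y (emb_gen_odd crossedV theta _).
  split=> h y; last by apply: etrans (e y) _; rewrite h subrr.
  by apply/eqP; rewrite -subr_eq0 -e; apply/eqP; exact: h.
split=> [[I [aI Igen]]|/centralE h].
  apply/centralE => y.
  have der s t : I (amul OmL s t) = amul OmL (I s) t + amul OmL (sgn par s) (I t).
    exact: (aug_der aI s t).
  have Ith : I (emb_gen H X theta theta) = emb_alg H X theta (i' theta).
    by have := Igen 1 theta; rewrite mul1r.
  pose t := amul OmL (emb_gen H X theta theta) (emb_gen H X theta theta).
  have It : I t = - om.
    by rewrite der Ith (sgn_emb_gen crossedV) amulNl; exact: i_theta_comm.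
  have st : sgn par t = t by apply: (even_sgn sO); exact: emb_th2_even.
  have : I (amul OmL t y) = I (amul OmL y t) by rewrite emb_th2_central.
  (* Both sides contain I(y) theta^2, since theta^2 is even and central. Cancelling it leaves the
     graded commutation of [om] with y, up to a common sign. *)
  rewrite (der t y) (der y t) It st amulNl amulNr emb_th2_central addrC => /addrI.
  by move/oppr_inj.
have la := aug_lin theta_inv i_lin i_act i_coact h.
pose E := Omega_theta H X theta.
pose I : {linear E -> E} := HB.pack_for {linear E -> E} (aug crossedV i' : E -> E)
  (GRing.isLinear.Build k E E *:%R (aug crossedV i' : E -> E) la).
exists I; split; last first.
  move=> a v; have gcov := Omega_covariant crossedV theta.
  rewrite (_ : Omega1 H X theta a v = amul OmL (emb_alg H X theta a)
    (emb_gen H X theta v)); last by rewrite emb_alg_gen.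
  apply: etrans (aug_alg_mul theta_inv i_lin i_act i_coact h a _) _.
  by rewrite (aug_emb_gen theta_inv i_lin i_act i_coact h) -(cp_mul gcov).
split=> [n s hs|s hs|s|s t|s].
- exact: (aug_deg_pred theta_inv i_lin i_act i_coact h hs).
- exact: (aug_deg_zero theta_inv i_lin i_act i_coact h hs).
- exact: (aug_aug theta_inv i_lin i_act i_coact h s).
- exact: (augM theta_inv i_lin i_act i_coact h s t).
- exact: (aug_cop theta_inv i_lin i_act i_coact h s).
Qed.
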